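(* Let $(\mathcal{X}, d)$ be a compact geodesic metric space. A subset $M\subset\mathcal{M}_1(\mathfrak{P})$, where $\mathfrak{P}=\mathfrak{P}(\mathcal{X})$, is precompact if and only if it is regular.
   Context: A metric space $\mathcal{X}$ is geodesic if any two points $x,y\in\mathcal{X}$ are joined by a path whose length (with respect to $d$) equals $d(x,y)$. Curves: $\mathcal{P}=\mathcal{P}(\mathcal{X})$ is the set of compact curves, i.e. continuous maps $\gamma:I^\gamma\to\mathcal{X}$ from a compact interval $I^\gamma$, up to reparametrization, with the metric $d_{\mathcal{P}}(\gamma,\eta)=\inf_\sigma\sup_{t\in I^\gamma}d(\gamma(t),\eta(\sigma(t)))$, the infimum being over increasing homeomorphisms $\sigma:I^\gamma\to I^\eta$ (curves at $d_{\mathcal{P}}$-distance $0$ are identified). Path collections: $\mathfrak{P}=\mathfrak{P}(\mathcal{X})$ is the set of countable multisets $\Gamma$ of elements of $\mathcal{P}$ such that for each $\delta>0$ the multiset $\Gamma(\delta):=\{\gamma\in\Gamma : \mathrm{diam}(\gamma)>\delta\}$ is finite and $\Gamma=\bigcup_{\delta>0}\Gamma(\delta)$ (so there are no constant paths). A matching between $\Gamma,\tilde\Gamma\in\mathfrak{P}$ is a set $\pi\subset\Gamma\times\tilde\Gamma$ such that the projections $\pi\to\Gamma$ and $\pi\to\tilde\Gamma$ are injective; $\Gamma^\pi\subset\Gamma$ and $\tilde\Gamma^\pi\subset\tilde\Gamma$ denote the elements not contained in any pair of $\pi$. The metric on $\mathfrak{P}$ is $$d_{\mathfrak{P}}(\Gamma,\tilde\Gamma)=\inf_\pi\max\Big(\sup_{(\gamma,\tilde\gamma)\in\pi}d_{\mathcal{P}}(\gamma,\tilde\gamma),\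 \sup_{\gamma\in\Gamma^\pi}\mathrm{diam}(\gamma),\ \sup_{\tilde\gamma\in\tilde\Gamma^\pi}\mathrm{diam}(\tilde\gamma)\Big),$$ the infimum being over all matchings $\pi$ (a supremum over the empty set is $0$). Crossings: for $x\in\mathcal{X}$ and $0<r<R<\infty$ let $A_{r,R}(x)=\{y\in\mathcal{X} : r<d(x,y)<R\}$. For a curve $\gamma:I\to\mathcal{X}$, $A^\gamma_{r,R}(x)$ is the set of intervals $(a,b)\subset I$ such that $\gamma((a,b))\subset A_{r,R}(x)$ and $\{d(x,\gamma(a)),d(x,\gamma(b))\}=\{r,R\}$; $N^\gamma_{r,R}(x):=|A^\gamma_{r,R}(x)|$ (independent of the parametrization), and $N^\Gamma_{r,R}(x):=\sum_{\gamma\in\Gamma}N^\gamma_{r,R}(x)$ for $\Gamma\in\mathfrak{P}$. $\mathcal{M}_1(\mathfrak{P})$ is the set of Borel probability measures on $(\mathfrak{P},d_{\mathfrak{P}})$ with the topology of weak convergence (convergence of integrals of bounded continuous functions). A subset $M$ is precompact if every sequence in $M$ has a subsequence converging weakly to some element of $\mathcal{M}_1(\mathfrak{P})$. A subset $M\subset\mathcal{M}_1(\mathfrak{P})$ is regular if for every $x\in\mathcal{X}$ and every $R>r>0$, $$\lim_{N\to\infty}\sup_{\mu\in M}\mu\big(\{\Gamma\in\mathfrak{P} : N^\Gamma_{r,R}(x)\ge N\}\big)=0.$$ *)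

(* Defs.v *)
From HB Require Import structures.
From mathcomp Require Import all_boot all_order all_algebra generic_quotient.
From mathcomp Require Import all_classical all_reals all_analysis.
From mathcomp Require Import ring lra.

Set Implicit Arguments.
Unset Strict Implicit.
Unset Printing Implicit Defensive.

Import Order.TTheory GRing.Theory Num.Theory.
Import numFieldNormedType.Exports.

Local Open Scope classical_set_scope.
Local Open Scope ring_scope.
Local Open Scope quotient_scope.

(* Supremum of a set of nonnegative extended reals, with value 0 on set0
   (where [ereal_sup] is -oo). *)
Definition esup0 {R : realType} (A : set (\bar R)) : \bar R :=
  ereal_sup (0%E |` A).

(* Only the values on [`[lo, hi]] matter. The interval is nondegenerate because
   no homeomorphism relates a point to a nondegenerate interval. *)
Record pcurve (R : realType) (X : metricType R) := PCurve {
  lo : R;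
  hi : R;
  pfun :> R -> X;
  lo_lt_hi : lo < hi;
  pcurve_continuous : {within `[lo, hi], continuous pfun} }.

HB.instance Definition _ (R : realType) (X : metricType R) :=
  gen_eqMixin (pcurve X).
HB.instance Definition _ (R : realType) (X : metricType R) :=
  gen_choiceMixin (pcurve X).

Section pcurves.
Context {R : realType} {X : metricType R}.
Implicit Types g h k : pcurve X.

Definition dom g : set R := `[lo g, hi g].

Definition pcurve_length g : \bar R :=
  ereal_sup [set (let F := g \o nth (hi g) (lo g :: s) in
                  \sum_(0 <= n < size s) mdist (F n) (F n.+1))%:E
            | s in itv_partition (lo g) (hi g)].

Definition pcurve_diam g : R :=
  sup [set mdist (g st.1) (g st.2) | st in dom g `*` dom g].

Definition increasing_homeo g h (s : R -> R) :=
  [/\ set_bij (dom g) (dom h) s,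
      {in dom g &, {homo s : x y / x < y}},
      {within dom g, continuous s} &
      exists2 s', {within dom h, continuous s'} & {in dom g, cancel s s'}].

Definition pcurve_dist g h : R :=
  inf [set sup [set mdist (g t) (h (s t)) | t in dom g]
      | s in increasing_homeo g h].

(* The intervals (u, v) are represented by their pairs of endpoints. *)
Definition crossing_set g (x : X) (r r' : R) : set (R * R) :=
  [set uv | [/\ uv.1 < uv.2, dom g uv.1, dom g uv.2,
    forall t, t \in `]uv.1, uv.2[ -> r < mdist x (g t) < r' &
    [set mdist x (g uv.1); mdist x (g uv.2)] = [set r; r'] ]].

Definition pcurve_crossings g x r r' : \bar R := counting (crossing_set g x r r').

Lemma domlo g : dom g (lo g).
Proof. by rewrite /dom /= in_itv /= lexx ltW // lo_lt_hi. Qed.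

Lemma domhi g : dom g (hi g).
Proof. by rewrite /dom /= in_itv /= lexx ltW // lo_lt_hi. Qed.

Lemma within_continuous_comp_in (T U V : topologicalType) (A : set T) (B : set U)
    (f : T -> U) (k : U -> V) : (forall x, A x -> B (f x)) ->
  {within A, continuous f} -> {within B, continuous k} ->
  {within A, continuous (k \o f)}.
Proof.
move=> AB /subspace_continuousP Cf /subspace_continuousP Ck.
apply/subspace_continuousP => x Ax.
apply: cvg_trans (Ck _ (AB _ Ax)) => P.
rewrite /nbhs /= /within /= => /(Cf x Ax); rewrite /within /nbhs /=.
by apply: filterS => y /[swap] Ay /(_ Ay); apply; exact: AB.
Qed.

Lemma mdist_continuous (x : X) : continuous (mdist x : X -> R).
Proof.
move=> y; apply/cvgrPdist_lt => e e0.
apply/nbhs_ballP; exists e => //= z; rewrite ballEmdist /= => yz.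
have h1 := metric_triangle x y z; have h2 := metric_triangle x z y.
rewrite (metric_sym z y) in h2.
by rewrite ltr_norml; apply/andP; split; lra.
Qed.

Lemma pcurve_bounded g (x : X) : exists B, forall t, dom g t -> mdist x (g t) <= B.
Proof.
have cf : {within `[lo g, hi g], continuous (mdist x \o g)}.
  apply: within_continuous_comp (pcurve_continuous (p:=g)).
  by move=> y _; exact: mdist_continuous.
have [c _ Hc] := EVT_max (ltW (lo_lt_hi g)) cf.
by exists (mdist x (g c)) => t; exact: Hc.
Qed.

Lemma pcurve_bounded2 g h :
  exists B, forall t u, dom g t -> dom h u -> mdist (g t) (h u) <= B.
Proof.
have [B1 H1] := pcurve_bounded g (g (lo g)).
have [B2 H2] := pcurve_bounded h (g (lo g)).
exists (B1 + B2) => t u Ht Hu.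
apply: le_trans (metric_triangle _ (g (lo g)) _) _.
by rewrite metric_sym lerD // ?H1 ?H2.
Qed.

Lemma pcurve_diam_ub g t u : dom g t -> dom g u -> mdist (g t) (g u) <= pcurve_diam g.
Proof.
move=> Ht Hu; apply: ub_le_sup; last by exists (t, u).
have [B HB] := pcurve_bounded2 g g.
by exists B => _ [[a b] [Ha Hb] <-]; exact: HB.
Qed.

Lemma pcurve_diam_le g e :
  (forall t u, dom g t -> dom g u -> mdist (g t) (g u) <= e) -> pcurve_diam g <= e.
Proof.
move=> H; apply: ge_sup.
  by exists (mdist (g (lo g)) (g (lo g))), (lo g, lo g) => //=; split; exact: domlo.
by move=> _ [[a b] [Ha Hb] <-]; exact: H.
Qed.

Lemma increasing_homeo_dom g h s : increasing_homeo g h s ->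
  forall t, dom g t -> dom h (s t).
Proof. by move=> [[+ _ _] _ _ _]; apply. Qed.

Lemma increasing_homeo_surj g h s : increasing_homeo g h s ->
  forall u, dom h u -> exists2 t, dom g t & s t = u.
Proof. by move=> [[_ _ +] _ _ _] u Hu => /(_ u Hu) [t Ht <-]; exists t. Qed.

Lemma increasing_homeo_id g : increasing_homeo g g id.
Proof.
split.
- by split => // t Ht; exists t.
- by move=> x y.
- by apply: continuous_subspaceT => x.
- by exists id => //; apply: continuous_subspaceT => x.
Qed.

Lemma increasing_homeo_inv g h s : increasing_homeo g h s ->
  exists2 s', increasing_homeo h g s' & {in dom h, cancel s' s}.
Proof.
move=> hs; have D := increasing_homeo_dom hs; have S := increasing_homeo_surj hs.
case: hs => [[_ I _] M C [s' C' K]].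
have K' : {in dom h, cancel s' s}.
  by move=> u; rewrite inE => /S[t Ht <-]; rewrite K ?inE.
have D' u : dom h u -> dom g (s' u).
  by move=> /S[t Ht <-]; rewrite K ?inE.
exists s' => //; split.
- split; first by [].
  + by move=> u v Hu Hv; rewrite -{2}(K' u) // -{2}(K' v) // => ->.
  + by move=> t Ht; exists (s t); [exact: D | rewrite K ?inE].
- move=> u v; rewrite !inE => Hu Hv uv.
  rewrite ltNge le_eqVlt; apply/negP => /orP[/eqP E|L].
    by move: uv; rewrite -(K' u) ?inE // -(K' v) ?inE // E ltxx.
  have := M _ _ (mem_set (D' _ Hv)) (mem_set (D' _ Hu)) L.
  by rewrite !K' ?inE // => /(lt_trans uv); rewrite ltxx.
- by [].
- by exists s.
Qed.

Lemma increasing_homeo_comp g h k s s' : increasing_homeo g h s ->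
  increasing_homeo h k s' -> increasing_homeo g k (s' \o s).
Proof.
move=> hs hs'; have D := increasing_homeo_dom hs; have S := increasing_homeo_surj hs.
have D' := increasing_homeo_dom hs'; have S' := increasing_homeo_surj hs'.
case: hs => [B M C [i Ci K]]; case: hs' => [B' M' C' [i' Ci' K']].
have Di u : dom h u -> dom g (i u) by move=> /S[t Ht <-]; rewrite K ?inE.
have Di' u : dom k u -> dom h (i' u) by move=> /S'[t Ht <-]; rewrite K' ?inE.
split.
- by apply: set_bij_comp B' .
- by move=> x y; rewrite !inE => Hx Hy xy; apply: M' => /=; rewrite ?inE; auto; apply: M; rewrite ?inE.
- exact: within_continuous_comp_in D C C'.
- exists (i \o i').
    exact: within_continuous_comp_in Di' Ci' Ci.
  by move=> t; rewrite inE => Ht /=; rewrite K' ?K ?inE //; exact: D.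
Qed.

Lemma increasing_homeo_ex g h : exists s, increasing_homeo g h s.
Proof.
have L (g' h' : pcurve X) t : dom g' t ->
    dom h' (lo h' + (t - lo g') * ((hi h' - lo h') / (hi g' - lo g'))).
  have := lo_lt_hi g'; have := lo_lt_hi h'.
  rewrite /dom /= !in_itv /= => Hh Hg /andP[Ha Hb].
  have p : 0 < hi g' - lo g' by lra.
  rewrite lerDl mulr_ge0 ?divr_ge0; try lra.
  by rewrite mulrA -lerBrDl ler_pdivrMr // mulrC ler_wpM2l; lra.
have C (g' h' : pcurve X) : {within dom g', continuous
    (fun t => lo h' + (t - lo g') * ((hi h' - lo h') / (hi g' - lo g')))}.
  apply: continuous_subspaceT => t; apply: cvgD; first exact: cvg_cst.
  by apply: cvgMl; apply: cvgB; [exact: cvg_id | exact: cvg_cst].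
have K (g' h' : pcurve X) t : lo g' + (lo h' +
    (t - lo g') * ((hi h' - lo h') / (hi g' - lo g')) - lo h') *
    ((hi g' - lo g') / (hi h' - lo h')) = t.
  by have := lo_lt_hi g'; have := lo_lt_hi h' => ? ?; field; lra.
exists (fun t => lo h + (t - lo g) * ((hi h - lo h) / (hi g - lo g))); split.
- split => [t|t u _ _ E|u Hu]; first exact: L.
    by rewrite -(K g h t) E K.
  exists (lo g + (u - lo h) * ((hi g - lo g) / (hi h - lo h))); first exact: L.
  exact: K.
- move=> t u _ _ tu; rewrite ltrD2l ltr_pM2r ?ltrD2r //.
  by have := lo_lt_hi g; have := lo_lt_hi h => ? ?; rewrite divr_gt0; lra.
- exact: C.
- by exists (fun u => lo g + (u - lo h) * ((hi g - lo g) / (hi h - lo h))).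
Qed.

Lemma pcurve_dist_le g h s e : increasing_homeo g h s ->
  (forall t, dom g t -> mdist (g t) (h (s t)) <= e) -> pcurve_dist g h <= e.
Proof.
move=> hs H; apply: (@le_trans _ _ (sup [set mdist (g t) (h (s t)) | t in dom g])).
  apply: ge_inf; last by exists s.
  exists 0 => _ [s' hs' <-].
  have [B HB] := pcurve_bounded2 g h.
  apply: le_trans (mdist_ge0 (g (lo g)) (h (s' (lo g)))) _.
  apply: ub_le_sup; last by exists (lo g) => //; exact: domlo.
  by exists B => _ [t Ht <-]; apply: HB => //; exact: (increasing_homeo_dom hs').
apply: ge_sup; first by exists (mdist (g (lo g)) (h (s (lo g)))), (lo g) => //; exact: domlo.
by move=> _ [t Ht <-]; exact: H.
Qed.

Lemma pcurve_dist_lt g h e : pcurve_dist g h < e ->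
  exists2 s, increasing_homeo g h s & forall t, dom g t -> mdist (g t) (h (s t)) < e.
Proof.
move=> /inf_lt[].
  have [s hs] := increasing_homeo_ex g h.
  by exists (sup [set mdist (g t) (h (s t)) | t in dom g]), s.
move=> _ [s hs <-] H; exists s => // t Ht; apply: le_lt_trans H.
apply: ub_le_sup; last by exists t.
have [B HB] := pcurve_bounded2 g h.
by exists B => _ [u Hu <-]; apply: HB => //; exact: (increasing_homeo_dom hs).
Qed.

Lemma pcurve_dist_ge0 g h : 0 <= pcurve_dist g h.
Proof.
rewrite leNgt; apply/negP => /pcurve_dist_lt[s _ /(_ _ (domlo g))].
by rewrite ltNge mdist_ge0.
Qed.

Lemma pcurve_distxx g : pcurve_dist g g = 0.
Proof.
apply/eqP; rewrite eq_le pcurve_dist_ge0 andbT.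
by apply: (pcurve_dist_le (increasing_homeo_id g)) => t _; rewrite mdistxx.
Qed.

Lemma pcurve_dist_sym g h : pcurve_dist g h = pcurve_dist h g.
Proof.
suff H g' h' : pcurve_dist g' h' <= pcurve_dist h' g'.
  by apply/eqP; rewrite eq_le !H.
apply/ler_addgt0Pl => e e0.
have [|s /increasing_homeo_inv[s' hs' K] H] := @pcurve_dist_lt h' g' (e + pcurve_dist h' g').
  by rewrite ltrDr.
apply: (pcurve_dist_le hs') => t Ht; rewrite metric_sym ltW //.
by have := H _ (increasing_homeo_dom hs' Ht); rewrite K ?inE // addrC.
Qed.

Lemma pcurve_dist_triangle h g k :
  pcurve_dist g k <= pcurve_dist g h + pcurve_dist h k.
Proof.
apply/ler_addgt0Pl => e e0.
have [|s hs H] := @pcurve_dist_lt g h (e / 2 + pcurve_dist g h).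
  by rewrite ltrDr divr_gt0.
have [|s' hs' H'] := @pcurve_dist_lt h k (e / 2 + pcurve_dist h k).
  by rewrite ltrDr divr_gt0.
apply: (pcurve_dist_le (increasing_homeo_comp hs hs')) => t Ht.
apply: le_trans (metric_triangle _ (h (s t)) _) _.
have := H _ Ht; have := H' _ (increasing_homeo_dom hs Ht) => /=.
lra.
Qed.

Lemma pcurve_diam_lip g h : pcurve_diam g <= pcurve_diam h + 2 * pcurve_dist g h.
Proof.
apply/ler_addgt0Pl => e e0.
have [|s hs H] := @pcurve_dist_lt g h (e / 2 + pcurve_dist g h).
  by rewrite ltrDr divr_gt0.
apply: pcurve_diam_le => t u Ht Hu.
have := H _ Ht; have := H _ Hu.
have := pcurve_diam_ub (increasing_homeo_dom hs Ht) (increasing_homeo_dom hs Hu).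
have := metric_triangle (g t) (h (s t)) (g u).
have := metric_triangle (h (s t)) (h (s u)) (g u).
rewrite (metric_sym (h (s u)) (g u)).
lra.
Qed.

Definition pcurve_equiv : rel (pcurve X) := fun g h => `[< pcurve_dist g h = 0 >].

Lemma pcurve_equiv_refl : reflexive pcurve_equiv.
Proof. by move=> g; apply/asboolP; exact: pcurve_distxx. Qed.

Lemma pcurve_equiv_sym : symmetric pcurve_equiv.
Proof. by move=> g h; rewrite /pcurve_equiv pcurve_dist_sym. Qed.

Lemma pcurve_equiv_trans : transitive pcurve_equiv.
Proof.
move=> h g k /asboolP E /asboolP E'; apply/asboolP/eqP.
by rewrite eq_le pcurve_dist_ge0 andbT (le_trans (pcurve_dist_triangle h _ _)) // E E' addr0.
Qed.

Canonical pcurve_equiv_rel :=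
  EquivRel pcurve_equiv pcurve_equiv_refl pcurve_equiv_sym pcurve_equiv_trans.

End pcurves.

Definition curve (R : realType) (X : metricType R) : Type :=
  {eq_quot (@pcurve_equiv R X)}.

Section curves.
Context {R : realType} {X : metricType R}.

HB.instance Definition _ := EqQuotient.on (curve X).
HB.instance Definition _ := Choice.on (curve X).

Let dist (p q : curve X) := pcurve_dist (repr p) (repr q).

Let dist_positivity p q : dist p q = 0 -> p = q.
Proof.
by move=> E; rewrite -[p]reprK -[q]reprK; apply/eqP; rewrite piE; apply/asboolP.
Qed.

HB.instance Definition _ := isMetric.Build R (curve X)
  (fun p => pcurve_distxx (repr p)) dist_positivity
  (fun p q => pcurve_dist_sym (repr p) (repr q))
  (fun q p r => pcurve_dist_triangle (repr q) (repr p) (repr r)).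

(* Curves at distance 0 have the same diameter and the same crossing numbers, so
   the choice of the representative is immaterial. *)
Definition diam (p : curve X) : R := pcurve_diam (repr p).

Definition crossings (p : curve X) (x : X) (r r' : R) : \bar R :=
  pcurve_crossings (repr p) x r r'.

Lemma mdist_curveE (p q : curve X) : mdist p q = pcurve_dist (repr p) (repr q).
Proof. by []. Qed.

Lemma diam_lip (p q : curve X) : diam p <= diam q + 2 * mdist p q.
Proof. exact: pcurve_diam_lip. Qed.

Lemma diam_ge0 (p : curve X) : 0 <= diam p.
Proof.
have := pcurve_diam_ub (domlo (repr p)) (domlo (repr p)).
by rewrite mdistxx.
Qed.

End curves.

Section occurrences.
Context {R : realType} {X : metricType R}.

(* The elements of the multiset with multiplicity function [m]: the k-th copy
   of p is (p, k), 0 <= k < m p. *)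
Definition occ (m : curve X -> nat) : set (curve X * nat) :=
  [set e | (e.2 < m e.1)%N].

End occurrences.

(* A multiset is given by its multiplicity function; finite multiplicities lose
   nothing since each [Gamma(delta)] is finite, and countability of the multiset
   follows from the two fields (lemma [countable_occ]). *)
Record collection (R : realType) (X : metricType R) := Collection {
  multiplicity :> curve X -> nat;
  mult_finite : forall delta : R, 0 < delta ->
    finite_set [set e | occ multiplicity e /\ delta < diam e.1];
  mult_diam : forall e, occ multiplicity e -> exists2 delta : R, 0 < delta & delta < diam e.1 }.

HB.instance Definition _ (R : realType) (X : metricType R) :=
  gen_eqMixin (collection X).
HB.instance Definition _ (R : realType) (X : metricType R) :=
  gen_choiceMixin (collection X).

Section collections.
Context {R : realType} {X : metricType R}.
Implicit Types (G H K : collection X) (pi : set ((curve X * nat) * (curve X * nat))).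

Lemma countable_occ G : countable (occ G).
Proof.
rewrite (_ : occ G = \bigcup_n [set e | occ G e /\ n.+1%:R^-1 < diam e.1]).
  apply: bigcup_countable => // n _.
  by apply/finite_set_countable/mult_finite; rewrite invr_gt0.
apply/seteqP; split=> [e He|e [n _ []]//].
have [d d0 dd] := mult_diam He.
have [n _ /(_ n (leqnn n)) /= nd] := near_infty_natSinv_lt (PosNum d0).
by exists n => //; split => //; exact: lt_trans nd dd.
Qed.

Definition empty_collection : collection X.
Proof.
exists (fun=> 0%N).
- move=> d _; rewrite (_ : [set e | _] = set0) //.
  by rewrite -subset0 => e [].
- by [].
Defined.

HB.instance Definition _ := isPointed.Build (collection X) empty_collection.

Definition matching G H pi :=
  [/\ pi `<=` occ G `*` occ H, set_inj pi fst & set_inj pi snd].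

Definition unmatched1 G pi := [set e | occ G e /\ forall e', ~ pi (e, e')].

Definition unmatched2 H pi := [set e | occ H e /\ forall e', ~ pi (e', e)].

Definition matching_cost G H pi : \bar R :=
  maxe (esup0 [set (mdist ee.1.1 ee.2.1)%:E | ee in pi])
    (maxe (esup0 [set (diam e.1)%:E | e in unmatched1 G pi])
          (esup0 [set (diam e.1)%:E | e in unmatched2 H pi])).

Definition coll_dist G H : \bar R :=
  ereal_inf [set matching_cost G H pi | pi in matching G H].

Lemma esup0_leP (T : Type) (A : set T) (f : T -> \bar R) (e : R) : 0 <= e ->
  (esup0 (f @` A) <= e%:E)%E <-> forall t, A t -> (f t <= e%:E)%E.
Proof.
move=> e0; split=> [H t At|H].
  by apply: le_trans H; apply: ereal_sup_ubound; right; exists t.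
by apply: ge_ereal_sup => _ [->|[t At <-]]; [rewrite lee_fin | exact: H].
Qed.

Lemma matching_cost_leP G H pi (e : R) : 0 <= e ->
  (matching_cost G H pi <= e%:E)%E <->
  [/\ forall a b, pi (a, b) -> mdist a.1 b.1 <= e,
      forall a, unmatched1 G pi a -> diam a.1 <= e &
      forall b, unmatched2 H pi b -> diam b.1 <= e].
Proof.
move=> e0; rewrite /matching_cost !ge_max; split.
  move=> /and3P[/(esup0_leP _ _ e0) h1 /(esup0_leP _ _ e0) h2 /(esup0_leP _ _ e0) h3].
  split=> [a b ab|a Ha|b Hb]; rewrite -lee_fin.
  - exact: (h1 (a, b)).
  - exact: h2.
  - exact: h3.
move=> [h1 h2 h3]; apply/and3P; split; apply/esup0_leP => // -[a b] ab.
by rewrite lee_fin; exact: h1.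
Qed.

Lemma coll_dist_le G H pi e : matching G H pi ->
  (matching_cost G H pi <= e)%E -> (coll_dist G H <= e)%E.
Proof. by move=> Hp; apply: le_trans; apply: ereal_inf_lbound; exists pi. Qed.

Lemma coll_dist_lt G H e : (coll_dist G H < e)%E ->
  exists2 pi, matching G H pi & (matching_cost G H pi <= e)%E.
Proof.
by move=> /ereal_inf_lt[_ [pi Hp <-] lt]; exists pi => //; exact: ltW.
Qed.

Lemma coll_distxx_le G : (coll_dist G G <= 0)%E.
Proof.
apply: (@coll_dist_le _ _ [set ee | ee.1 = ee.2 /\ occ G ee.1]).
  split=> [[a b] /= [<- Ha]//|[a b] [a' b'] |[a b] [a' b']];
  by rewrite !inE /= => -[<- _] [<- _] ->.
apply/matching_cost_leP => //; split=> [a b [/= <- _]|a [Ha /(_ a)[]//]|b [Hb /(_ b)[]//]].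
by rewrite mdistxx.
Qed.

Lemma coll_dist_sym G H : coll_dist G H = coll_dist H G.
Proof.
suff L G' H' : (coll_dist G' H' <= coll_dist H' G')%E.
  by apply/eqP; rewrite eq_le !L.
apply: le_ereal_inf_tmp => _ [pi [Hs H1 H2] <-].
apply: (@coll_dist_le _ _ [set ee | pi (ee.2, ee.1)]).
  split=> [[a b] /= /Hs[]//|[a b] [a' b']|[a b] [a' b']];
    rewrite !inE /= => p p' E.
  - by have [-> ->] := H2 _ _ (mem_set p) (mem_set p') E.
  - by have [-> ->] := H1 _ _ (mem_set p) (mem_set p') E.
rewrite le_eqVlt; apply/orP; left; apply/eqP.
rewrite /matching_cost; congr (maxe (esup0 _) _); last exact: maxC.
apply/seteqP; split=> _ [[a b] /= p <-]; exists (b, a) => //=;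
by rewrite metric_sym.
Qed.

(* The triangle inequality itself fails for [coll_dist]: matching a segment of
   length 3 with its middle third costs 1, leaving the latter unmatched costs 1,
   but leaving the former unmatched costs 3. *)
Lemma coll_dist_triangle H G K (e : R) : 0 <= e ->
  (coll_dist G H < e%:E)%E -> (coll_dist H K < e%:E)%E ->
  (coll_dist G K <= (3 * e)%:E)%E.
Proof.
move=> e0 /coll_dist_lt[pi [Hs H1 H2] /(matching_cost_leP _ _ _ e0)[c1 c2 c3]].
move=> /coll_dist_lt[pi' [Hs' H1' H2'] /(matching_cost_leP _ _ _ e0)[c1' c2' c3']].
apply: (@coll_dist_le _ _ [set ee | exists2 b, pi (ee.1, b) & pi' (b, ee.2)]).
  split=> [[a c] /= [b /Hs[/= Ha _] /Hs'[]]//|[a c] [a' c']|[a c] [a' c']];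
    rewrite !inE /= => -[b p q] [b' p' q'] E.
  - rewrite -E in p'; have [bE] := H1 _ _ (mem_set p) (mem_set p') erefl.
    rewrite -bE in q'; have [->] := H1' _ _ (mem_set q) (mem_set q') erefl.
    by rewrite E.
  - rewrite -E in q'; have [bE] := H2' _ _ (mem_set q) (mem_set q') erefl.
    rewrite -bE in p'; have [->] := H2 _ _ (mem_set p) (mem_set p') erefl.
    by rewrite E.
have e3 : 0 <= 3 * e by rewrite mulr_ge0.
apply/matching_cost_leP => //; split=> [a c [b /c1 p /c1' q]|a [Ha un]|c [Hc un]].
- have := metric_triangle a.1 b.1 c.1; move: p q => /=; lra.
- have [[b pb]|nb] := pselect (exists b, pi (a, b)); last first.
    have := c2 a; rewrite /unmatched1 /= => /(_ _)/le_trans -> //; last lra.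
    by split=> // b pb; apply: nb; exists b.
  have [/= _ Hb] := Hs _ pb.
  have : diam b.1 <= e.
    by apply: c2'; split=> // c pc; apply: (un c); exists b.
  have := diam_lip a.1 b.1; have := c1 _ _ pb; lra.
- have [[b pb]|nb] := pselect (exists b, pi' (b, c)); last first.
    have := c3' c; rewrite /unmatched2 /= => /(_ _)/le_trans -> //; last lra.
    by split=> // b pb; apply: nb; exists b.
  have [/= Hb _] := Hs' _ pb.
  have : diam b.1 <= e.
    by apply: c3; split=> // a pa; apply: (un a); exists b.
  have := diam_lip c.1 b.1; have := c1' _ _ pb; rewrite (metric_sym c.1); lra.
Qed.

Let ent : set_system (collection X * collection X) :=
  entourage_ (fun G (e : R) => [set H | (coll_dist G H < e%:E)%E]).

Let ent_filter : Filter ent.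
Proof.
apply: filter_from_filter; first by exists 1 => /=.
move=> e1 e2 /= e10 e20; exists (Num.min e1 e2); first by rewrite /= lt_min e10.
by move=> [G H] /=; rewrite EFin_min lt_min => /andP[].
Qed.

Let ent_diagonal A : ent A -> diagonal `<=` A.
Proof.
move=> [e e0 sA] [G H] GH; have {GH}-> : G = H by []; apply: sA => /=.
by apply: le_lt_trans (coll_distxx_le H) _; rewrite lte_fin.
Qed.

Let ent_inv A : ent A -> ent A^-1%relation.
Proof.
by move=> [e e0 sA]; exists e => // -[G H] /= GH; apply: sA; rewrite /= coll_dist_sym.
Qed.

Let ent_split A : ent A -> exists2 B, ent B & (B \; B)%relation `<=` A.
Proof.
move=> [e e0 sA]; exists [set GH | (coll_dist GH.1 GH.2 < (e / 4)%:E)%E].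
  by exists (e / 4) => //=; rewrite divr_gt0.
move=> [G K] [H /= GH HK]; apply: sA => /=.
have e4 : 0 <= e / 4 by rewrite ltW // divr_gt0.
apply: le_lt_trans (coll_dist_triangle e4 GH HK) _.
by rewrite lte_fin; move: e0 => /=; lra.
Qed.

(* By [coll_dist_triangle] the balls of [coll_dist] generate a uniform structure,
   hence the topology in which they form neighborhood bases. *)
HB.instance Definition _ := isUniform.Build (collection X)
  ent_filter ent_diagonal ent_inv ent_split.

Lemma nbhs_collP G (A : set (collection X)) :
  nbhs G A <-> exists2 e : R, 0 < e & forall H, (coll_dist G H < e%:E)%E -> A H.
Proof.
rewrite -nbhs_entourageE; split.
  move=> [B [e e0 sB] BA]; exists e => // H GH; apply: BA.
  by rewrite /xsection /= inE; apply: sB.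
move=> [e e0 H]; exists [set GH | (coll_dist GH.1 GH.2 < e%:E)%E].
  by exists e.
by move=> K; rewrite /xsection /= inE /=; exact: H.
Qed.

Definition coll_crossings G (x : X) (r r' : R) : \bar R :=
  (\esum_(e in occ G) crossings e.1 x r r')%E.

End collections.

Definition borel_collection (R : realType) (X : metricType R) :=
  g_sigma_algebraType (@open (collection X)).

Section measures.
Context {R : realType} {X : metricType R}.
Local Notation M1 := (probability (borel_collection X) R).

Definition weak_cvg (mu_ : nat -> M1) (mu : M1) :=
  forall f : collection X -> R, continuous f -> bounded_fun f ->
    (\int[mu_ n]_G (f G)%:E)%E @[n --> \oo] --> (\int[mu]_G (f G)%:E)%E.

Definition weakly_precompact (M : set M1) :=
  forall mu_ : nat -> M1, (forall n, M (mu_ n)) ->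
    exists phi : nat -> nat, increasing_seq phi /\
      exists mu : M1, weak_cvg (mu_ \o phi) mu.

(* The events below are closed, hence Borel. *)
Definition regular_measures (M : set M1) :=
  forall (x : X) (r r' : R), 0 < r -> r < r' ->
    esup0 [set mu [set G | (N%:R%:E <= coll_crossings G x r r')%E] | mu in M]
      @[N --> \oo] --> 0%E.

End measures.

Definition geodesic (R : realType) (X : metricType R) :=
  forall x y : X, exists g : pcurve X,
    [/\ g (lo g) = x, g (hi g) = y & pcurve_length g = (mdist x y)%:E].

(* Main.v *)
(* [d_P] is complete: a fast Cauchy sequence of curves can be pulled back, by
   composing almost optimal homeomorphisms, to the domain of its first member,
   where it converges uniformly. A curve with few crossings of the annuli
   A_{e,2e}(p), p in a finite e-net, splits into few pieces of diameter O(e),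
   and recording for each piece the nearby net point leaves finitely many
   possibilities up to d_P-distance O(e). Hence bounds on these crossing numbers
   for a sequence of scales e -> 0 give compactness of curves; since they also
   bound the number of curves of diameter > 8e, enumerating the collections by
   decreasing scale and extracting a diagonal subsequence gives compactness of
   collections. Regularity says that these bounds hold with probability close to
   1, uniformly over M, so M is tight and Prohorov's theorem applies.
   Conversely the events {N >= n} are closed and decrease to the empty set, so
   by the portmanteau theorem their probabilities cannot stay bounded below
   along a weakly convergent sequence. *)
From HB Require Import structures.
Require Import Defs.
From mathcomp Require Import all_boot all_order all_algebra finmap.
From mathcomp Require Import all_classical all_reals all_analysis.
From mathcomp Require Import measurable_realfun zify ring lra.

Set Implicit Arguments.
Unset Strict Implicit.
Unset Printing Implicit Defensive.

Import Order.TTheory GRing.Theory Num.Theory.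
Import numFieldNormedType.Exports.

Local Open Scope classical_set_scope.
Local Open Scope ring_scope.

(** The triangle inequality for [coll_dist] holds only up to a factor 3, so [collection X] is
    treated as a uniform space with a countable base of entourages, and the two classical theorems
    are proved in forms that need no metric. In the portmanteau bound for closed sets, Urysohn
    functions replace the distance to the set. Prohorov's theorem asks for closed, sequentially
    compact sets [K k] and for countably many open sets forming a base at the points of the [K k].
    The events {N >= n} are closed because crossing numbers are upper semicontinuous: if curves
    close to g had more crossings than g, these crossings would converge to non-overlapping
    intervals, each containing a crossing of g. For collections the obstacle is that members carry
    no order. Giving each curve an index whose range is bounded in terms of its diameter, uniformly
    over all the collections considered, reduces convergence to convergence at each index. *)

Local Notation borel T := (g_sigma_algebraType (@open T)).

(** * Subsequences *)

Lemma increasing_seq_le (f : nat -> nat) : increasing_seq f -> forall n, (n <= f n)%N.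
Proof.
move=> fi; elim=> // n ih; apply: leq_ltn_trans ih _.
by have /increasing_seqP := fi; exact.
Qed.

Lemma increasing_seq_comp (f g : nat -> nat) :
  increasing_seq f -> increasing_seq g -> increasing_seq (f \o g).
Proof. by move=> fi gi m n /=; rewrite fi -leEnat gi. Qed.

Lemma increasing_seq_cvg (f : nat -> nat) : increasing_seq f -> f @ \oo --> \oo.
Proof.
move=> fi A [N _ NA]; exists N => // n /= Nn; apply: NA => /=.
exact: leq_trans Nn (increasing_seq_le fi n).
Qed.

(** The stability hypothesis lets [psi] be a subsequence of [phi] only after [m] terms, because the
    diagonal [F n n] is a subsequence of [F i.+1] only from index [i.+1] on. *)
Lemma diagonal_subsequence (P : nat -> (nat -> nat) -> Prop) :
  (forall i phi, increasing_seq phi ->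
    exists2 th, increasing_seq th & P i (phi \o th)) ->
  (forall i phi psi m, P i phi ->
    (exists2 th, increasing_seq th & forall n, psi (n + m)%N = phi (th n)) ->
    P i psi) ->
  exists2 phi, increasing_seq phi & forall i, P i phi.
Proof.
move=> ex stable.
have /choice[th0 th0P] : forall x : nat * (nat -> nat), exists th,
    increasing_seq x.2 -> increasing_seq th /\ P x.1 (x.2 \o th).
  move=> [i phi]; have [/ex-/(_ i)[th ? ?]|nphi] := pselect (increasing_seq phi).
    by exists th.
  by exists id.
pose F := fix F n := if n is m.+1 then F m \o th0 (m, F m) else id.
pose th n := th0 (n, F n).
have Fi n : increasing_seq (F n).
  elim: n => [//|n ih /=]; apply: increasing_seq_comp => //.
  by have [] := th0P (n, F n) ih.
have thi n : increasing_seq (th n) by have [] := th0P (n, F n) (Fi n).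
exists (fun n => F n n).
  apply/increasing_seqP => n /=; rewrite (leW_mono (Fi n)).
  exact: (increasing_seq_le (thi n) n.+1).
move=> i; have [_ Pi] := th0P (i, F i) (Fi i).
apply: (stable _ _ _ i.+1 Pi).
(* [Th n] composes the refinements made after stage [i.+1], so the tail of the diagonal factors
   through [F i.+1]. *)
pose Th := fix Th n := if n is m.+1 then Th m \o th (i.+1 + m)%N else id.
have ThE n : F (n + i.+1)%N = F i.+1 \o Th n.
  by elim: n => [//|n ih]; rewrite addSn /= /th (addnC i.+1 n) ih.
have Thi n : increasing_seq (Th n).
  by elim: n => [//|n ih] /=; apply: increasing_seq_comp.
exists (fun n => Th n (n + i.+1)%N).
  apply/increasing_seqP => n /=; rewrite (leW_mono (Thi n)).
  exact: (increasing_seq_le (thi (i.+1 + n)%N) (n.+1 + i.+1)%N).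
by move=> n; rewrite ThE.
Qed.

Lemma frequently_subsequence (P : nat -> nat -> Prop) :
  (forall k n, exists2 p, (n <= p)%N & P k p) ->
  exists2 phi, increasing_seq phi & forall k, P k (phi k).
Proof.
move=> H.
have /choice[f fP] : forall kn : nat * nat, exists p, (kn.2 <= p)%N /\ P kn.1 p.
  by move=> [k n]; have [p] := H k n; exists p.
pose phi := fix phi k := if k is j.+1 then f (k, (phi j).+1) else f (0, 0)%N.
exists phi; last by case=> [|k] /=; [case: (fP (0, 0)%N) | case: (fP (k.+1, (phi k).+1))].
by apply/increasing_seqP => n; have [] := fP (n.+1, (phi n).+1).
Qed.

Lemma cvg_subsequence (T : topologicalType) (u : nat -> T) (f : nat -> nat) (l : T) :
  increasing_seq f -> u @ \oo --> l -> u \o f @ \oo --> l.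
Proof. by move=> /increasing_seq_cvg fi ul; apply: cvg_comp fi ul. Qed.

Lemma compact_cvg_subsequence (R : realType) (T : pseudoMetricType R) (A : set T)
    (u : nat -> T) : compact A -> (forall n, A (u n)) ->
  exists2 phi, increasing_seq phi & exists2 l, A l & u \o phi @ \oo --> l.
Proof.
move=> cA Au; have [|l [Al cl]] := cA (u @ \oo) _.
  by exists 0%N => // n _; exact: Au.
have [k n|phi phii Hphi] :=
    @frequently_subsequence (fun k p => ball l k.+1%:R^-1 (u p)).
  have [||x [[p /= np <-] bx]] := cl (u @` [set p | (n <= p)%N]) (ball l k.+1%:R^-1).
  - by exists n => // p np; exists p.
  - by apply: nbhsx_ballx; rewrite invr_gt0.
  - by exists p.
exists phi => //; exists l => //; apply/cvg_ballP => e e0.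
have [N _ HN] := near_infty_natSinv_lt (PosNum e0).
exists N => // n /HN /= /ltW lt; exact: (le_ball lt).
Qed.

Lemma finite_range_constant_subsequence (T : Type) (u : nat -> T) :
  finite_set (range u) ->
  exists2 phi, increasing_seq phi & exists x, forall n, u (phi n) = x.
Proof.
move=> /finite_range_cst_subsequence[x [A Aoo Ax]].
have [|f [fi _ Af]] := infinite_increasing_seq_wf _ Aoo 0%N.
  by move=> n; apply: sub_finite_set (finite_II n.+1) => m /=.
by exists f => //; exists x => n; apply/Ax.
Qed.

(** * The portmanteau theorem *)

Lemma open_borel (T : ptopologicalType) (A : set T) :
  open A -> measurable (A : set (borel T)).
Proof. by move=> oA; apply: sub_sigma_algebra. Qed.

Lemma closed_borel (T : ptopologicalType) (A : set T) :
  closed A -> measurable (A : set (borel T)).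
Proof.
move=> cA; rewrite -[A]setCK; apply: measurableC.
by apply: open_borel; exact: closed_openC.
Qed.

Lemma continuous_borel (R : realType) (T : ptopologicalType) (f : T -> R) :
  continuous f -> measurable_fun setT (f : borel T -> R).
Proof.
move=> /continuousP cf; apply: (measurability _ (RGenOpens.measurableE R)).
move=> _ [_ [a [b ->] <-]]; rewrite setTI; apply: open_borel.
by apply: cf; exact: interval_open.
Qed.

(** The sum is [d] times the number of multiples [d, 2 d, ..., m d] strictly below [x], so it rounds
    [x] down with error at most [d]. Strictness makes the level sets of a continuous function
    open. *)
Lemma staircase (R : realType) (x d : R) m : 0 <= d -> 0 <= x <= m%:R * d ->
  \sum_(0 <= i < m) d * (i.+1%:R * d < x)%R%:R <= x <=
  d + \sum_(0 <= i < m) d * (i.+1%:R * d < x)%R%:R.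
Proof.
move=> d0; elim: m => [|m ih]; first by rewrite big_geq //; lra.
move=> /andP[x0 xm]; rewrite big_nat_recr //=.
have [xm'|xm'] := leP x (m%:R * d).
  have -> : (m.+1%:R * d < x) = false.
    by apply/negbTE; rewrite -leNgt; move: xm'; rewrite -natr1; lra.
  by rewrite mulr0 addr0 ih // x0.
have -> : \sum_(0 <= i < m) d * (i.+1%:R * d < x)%R%:R = m%:R * d.
  rewrite big_mkord (eq_bigr (fun=> d)) => [|i _].
    by rewrite sumr_const card_ord mulr_natl.
  rewrite (_ : (_ < _) = true) ?mulr1 //; apply: le_lt_trans xm'.
  by rewrite ler_wpM2r // ler_nat.
move: xm; rewrite -natr1 => xm.
case: (ltP ((m%:R + 1) * d) x) => h /=; lra.
Qed.

Section portmanteau.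
Context {R : realType} {T : ptopologicalType}.
Local Notation M1 := (probability (borel T) R).

Lemma integral_staircase (mu : M1) (U : nat -> set T) (d : R) m : 0 <= d ->
  (forall i, open (U i)) ->
  (\int[mu]_x (\sum_(0 <= i < m) d * \1_(U i) x)%:E =
   (\sum_(0 <= i < m) d * fine (mu (U i)))%:E)%E.
Proof.
move=> d0 oU; have mU i : measurable (U i : set (borel T)) by exact: open_borel.
under eq_integral do rewrite -sumEFin.
rewrite ge0_integral_sum //; last 2 first.
- move=> i; apply/measurable_EFinP; apply: measurable_funM => //.
- by move=> i x _; rewrite lee_fin mulr_ge0.
rewrite -sumEFin; apply: eq_bigr => i _.
under eq_integral do rewrite EFinM.
rewrite ge0_integralZl_EFin //; last exact/measurable_EFinP.
by rewrite integral_indic // setIT EFinM fineK // fin_num_measure.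
Qed.

Lemma integral_staircase_bounds (mu : M1) (f : T -> R) (d : R) m : continuous f ->
  0 <= d -> (forall x, 0 <= f x <= m%:R * d) ->
  forall s, s = \sum_(0 <= i < m) d * fine (mu [set x | i.+1%:R * d < f x]) ->
  (s%:E <= \int[mu]_x (f x)%:E <= (d + s)%:E)%E.
Proof.
move=> cf d0 fm s ->.
have oU i : open [set x | i.+1%:R * d < f x].
  have -> : [set x | i.+1%:R * d < f x] = f @^-1` `]i.+1%:R * d, +oo[.
    by apply/seteqP; split=> x /=; rewrite in_itv /= andbT.
  by move/continuousP : cf; apply; exact: interval_open.
have mU i : measurable ([set x | i.+1%:R * d < f x] : set (borel T)) by exact: open_borel.
have mf := continuous_borel cf.
have sE := integral_staircase mu m d0 oU.
have b x := staircase d0 (fm x).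
have mS : measurable_fun setT
   (fun x : borel T => \sum_(0 <= i < m) d * \1_([set x | i.+1%:R * d < f x]) x : R).
  by apply: measurable_sum => i; apply: measurable_funM.
have indE i x : \1_([set x | i.+1%:R * d < f x]) x = (i.+1%:R * d < f x)%R%:R :> R.
  by rewrite indicE mem_setE.
have S0 x : 0 <= \sum_(0 <= i < m) d * \1_([set x | i.+1%:R * d < f x]) x :> R.
  by apply: sumr_ge0 => i _; rewrite mulr_ge0.
rewrite -sE; apply/andP; split.
  apply: ge0_le_integral => //.
  - by move=> x _; rewrite lee_fin.
  - exact/measurable_EFinP.
  - exact/measurable_EFinP.
  - move=> x _; rewrite lee_fin; have /andP[+ _] := b x; apply: le_trans.
    by apply: ler_sum => i _; rewrite indE.
have dE : (\int[mu]_x (cst d%:E x) = d%:E)%E.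
  rewrite integral_cst // -[RHS]mule1; congr (_ * _)%E; exact: (probability_setT mu).
rewrite EFinD -sE -[X in (_ <= X + _)%E]dE.
have <- := @ge0_integralD _ (borel T) R mu setT measurableT (cst d%:E)
   (fun x => (\sum_(0 <= i < m) d * \1_[set x | i.+1%:R * d < f x] x)%:E).
apply: ge0_le_integral => //.
- by move=> x _; rewrite lee_fin; have /andP[] := fm x.
- exact/measurable_EFinP.
- by apply/measurable_EFinP; apply: measurable_funD.
- move=> x _; rewrite -EFinD lee_fin; have /andP[_ +] := b x; move=> /le_trans; apply.
  by rewrite lerD2l; apply: ler_sum => i _; rewrite indE.
- by move=> x _; rewrite lee_fin.
- by [].
- by move=> x _; rewrite lee_fin.
- exact/measurable_EFinP.
Qed.

End portmanteau.

Lemma near_forall_lt (F : set_system nat) (FF : Filter F) (P : nat -> nat -> Prop) m :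
  (forall i, \forall n \near F, P i n) -> \forall n \near F, forall i, (i < m)%N -> P i n.
Proof.
move=> FP; elim: m => [|m ih]; first exact: nearW.
near=> n => i; rewrite ltnS leq_eqVlt => /orP[/eqP ->|im].
  by near: n; exact: FP.
by move: i im; near: n; exact: ih.
Unshelve. all: by end_near. Qed.

Section portmanteau_open.
Context {R : realType} {T : ptopologicalType}.
Local Notation M1 := (probability (borel T) R).
Variables (mu_ : nat -> M1) (mu : M1).
Hypothesis mu_open : forall (G : set T) (e : R), open G -> 0 < e ->
  \forall n \near \oo, (mu G <= mu_ n G + e%:E)%E.

Lemma le_integral_near (f : T -> R) (C e : R) : continuous f -> 0 < C -> 0 < e ->
  (forall x, 0 <= f x <= C) ->
  \forall n \near \oo, (\int[mu]_x (f x)%:E <= \int[mu_ n]_x (f x)%:E + e%:E)%E.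
Proof.
move=> cf C0 e0 fC.
(* So many levels that the mesh [d] is at most [e / 2]. *)
pose m := (Num.truncn (2 * C / e)).+1; pose d := C / m%:R.
have m0 : 0 < m%:R :> R by rewrite ltr0n.
have md : m%:R * d = C by rewrite /d mulrC divfK // gt_eqF.
have d0 : 0 <= d by rewrite divr_ge0 // ltW.
have de : d <= e / 2.
  have : 2 * C / e < m%:R by apply: truncnS_gt.
  rewrite ltr_pdivrMr // => h; rewrite /d ler_pdivrMr //; lra.
have fm x : 0 <= f x <= m%:R * d by rewrite md.
pose s (nu : M1) := \sum_(0 <= i < m) d * fine (nu [set x | i.+1%:R * d < f x]).
have sP nu : ((s nu)%:E <= \int[nu]_x (f x)%:E <= (d + s nu)%:E)%E.
  exact: integral_staircase_bounds fm _ erefl.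
have oU i : open [set x | i.+1%:R * d < f x].
  have -> : [set x | i.+1%:R * d < f x] = f @^-1` `]i.+1%:R * d, +oo[.
    by apply/seteqP; split=> x /=; rewrite in_itv /= andbT.
  by move/continuousP : cf; apply; exact: interval_open.
(* Allowed error per level: with weight [d] on each of [m] levels and [m * d = C], the total is
   [e / 2]. *)
have e'0 : 0 < e / (2 * C) by rewrite divr_gt0 // mulr_gt0.
have near_s : \forall n \near \oo, s mu <= s (mu_ n) + e / 2.
  near=> n.
  have H i : (i < m)%N -> fine (mu [set x | i.+1%:R * d < f x]) <=
      fine (mu_ n [set x | i.+1%:R * d < f x]) + e / (2 * C).
    move=> im; rewrite -lee_fin EFinD !fineK; last 2 first.
    - by rewrite fin_num_measure //; exact: open_borel.
    - by rewrite fin_num_measure //; exact: open_borel.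
    move: i im; near: n; apply: near_forall_lt => i.
    exact: mu_open.
  have -> : e / 2 = \sum_(0 <= i < m) d * (e / (2 * C)).
    rewrite sumr_const_nat subn0 -[RHS]mulr_natl mulrA md.
    by field; rewrite gt_eqF.
  rewrite /s -big_split /= !big_mkord; apply: ler_sum => i _.
  by rewrite -mulrDr ler_wpM2l // H.
near=> n; have /andP[_ h1] := sP mu; have /andP[h2 _] := sP (mu_ n).
apply: le_trans h1 _; apply: le_trans (leeD2r _ h2).
rewrite -EFinD lee_fin; have : s mu <= s (mu_ n) + e / 2 by near: n.
lra.
Unshelve. all: by end_near. Qed.

(** The one-sided estimate [le_integral_near], applied to the nonnegative functions [f + C] and
    [C - f], bounds the difference of the integrals from both sides. *)
Lemma portmanteau_open (f : T -> R) : continuous f -> bounded_fun f ->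
  (\int[mu_ n]_x (f x)%:E)%E @[n --> \oo] --> (\int[mu]_x (f x)%:E)%E.
Proof.
move=> cf [N [_ HN]].
pose C := `|N| + 1.
have C0 : 0 < C by rewrite ltr_wpDl.
have fC x : `|f x| <= C.
  by apply: (HN C); rewrite // (le_lt_trans (ler_norm N)) // ltrDl.
have mf := continuous_borel cf.
have if_ (nu : M1) : nu.-integrable setT (EFin \o (f : borel T -> R)).
  apply: measurable_bounded_integrable => //.
  - apply: (@le_lt_trans _ _ 1%E); last exact: ltry.
    by rewrite le_eqVlt; apply/orP; left; apply/eqP; exact: (probability_setT nu).
  - exists C; split; first exact: num_real.
    by move=> x Cx y _; apply: le_trans (fC y) (ltW Cx).
have ic (nu : M1) : nu.-integrable setT (EFin \o (cst C : borel T -> R)).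
  exact: finite_measure_integrable_cst.
pose r (nu : M1) := Rintegral nu setT (f : borel T -> R).
have rE (nu : M1) : (\int[nu]_x (f x)%:E = (r nu)%:E)%E.
  by rewrite /r /Rintegral fineK //; exact: integrable_fin_num (if_ nu).
have rc (nu : M1) : Rintegral nu setT (cst C : borel T -> R) = C.
  suff H : (\int[nu]_x (cst C%:E x) = C%:E)%E by rewrite /Rintegral [X in fine X]H.
  by rewrite integral_cst // -[RHS]mule1; congr (_ * _)%E; exact: (probability_setT nu).
have rD (nu : M1) : (\int[nu]_x (f x + C)%:E = (r nu + C)%:E)%E.
  rewrite -[in RHS](rc nu) -(RintegralD measurableT (if_ nu) (ic nu)) /Rintegral fineK //.
  exact: integrable_fin_num (integrableD measurableT (if_ nu) (ic nu)).
have rB (nu : M1) : (\int[nu]_x (C - f x)%:E = (C - r nu)%:E)%E.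
  rewrite -[in RHS](rc nu) -(RintegralB measurableT (ic nu) (if_ nu)) /Rintegral fineK //.
  exact: integrable_fin_num (integrableB measurableT (ic nu) (if_ nu)).
rewrite rE (_ : (fun n => _) = (fun n => (r (mu_ n))%:E)); last by apply/funext => n; rewrite rE.
apply: cvg_EFin; first exact: nearW.
apply/cvgrPdist_le => e e0.
have C2 : 0 < 2 * C by rewrite mulr_gt0.
have cD : continuous (fun x => f x + C) by move=> x; apply: cvgD; [exact: cf | exact: cvg_cst].
have cB : continuous (fun x => C - f x) by move=> x; apply: cvgB; [exact: cvg_cst | exact: cf].
have bD x : 0 <= f x + C <= 2 * C by have := fC x; rewrite ler_norml => /andP[]; lra.
have bB x : 0 <= C - f x <= 2 * C by have := fC x; rewrite ler_norml => /andP[]; lra.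
have A := le_integral_near cD C2 e0 bD.
have B := le_integral_near cB C2 e0 bB.
near=> n; rewrite ler_norml /=.
have : (\int[mu]_x (f x + C)%:E <= \int[mu_ n]_x (f x + C)%:E + e%:E)%E by near: n.
have : (\int[mu]_x (C - f x)%:E <= \int[mu_ n]_x (C - f x)%:E + e%:E)%E by near: n.
rewrite !rD !rB -!EFinD !lee_fin; lra.
Unshelve. all: by end_near. Qed.

End portmanteau_open.

Section portmanteau_closed.
Local Open Scope relation_scope.
Context {R : realType} {T : puniformType}.
Local Notation M1 := (probability (borel T) R).

(** [u k] vanishes on [F] and is 1 outside the entourage neighborhood [V k] of [F]. Multiplying the
    factors [1 - u j] makes the positivity sets decrease with [k]; they lie in [V k], and a point in
    every [V k] is in the closure of [F]. *)
Lemma closed_zero_sets (F : set T) : countable_uniformity T -> closed F ->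
  exists h : nat -> T -> R, [/\ forall k, continuous (h k),
    forall k x, 0 <= h k x <= 1, forall k x, F x -> h k x = 1,
    forall k x, 0 < h k.+1 x -> 0 < h k x &
    \bigcap_k [set x | 0 < h k x] = F].
Proof.
move=> /countable_uniformityP[f fE entf] cF.
pose V k := \bigcup_(y in F) xsection (f k) y.
pose u k := @Urysohn T R F (~` V k).
have sep k : uniform_separator F (~` V k).
  apply: uniform_separatorW; exists (f k) => //.
  rewrite -subset0 => -[y x] [[/= Fy nVx] fyx]; apply: nVx; exists y => //.
  exact/xsectionP.
have u0 k x : F x -> u k x = 0.
  by move=> Fx; apply: (@Urysohn_sub0 T R F (~` V k) (sep k)); exists x.
have u01 k x : 0 <= u k x <= 1.
  by have /(_ (u k x)) := @Urysohn_range T R F (~` V k); rewrite /= in_itv /=; apply; exists x.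
exists (fun k x => \prod_(j < k.+1) (1 - u j x)).
have h0 k x : 0 <= \prod_(j < k.+1) (1 - u j x).
  by apply: prodr_ge0 => j _; have := u01 j x; lra.
split.
- move=> k; apply: continuous_big; first exact: mul_continuous.
  by move=> j _ x; apply: cvgB; [exact: cvg_cst | exact: Urysohn_continuous].
- move=> k x; rewrite h0 /=; apply: prodr_ile1 => j _.
  by have := u01 j x; lra.
- by move=> k x Fx; apply: big1 => j _; rewrite u0 // subr0.
- move=> k x; rewrite big_ord_recr /= !lt0r h0 andbT => /andP[+ _].
  by rewrite mulf_eq0 negb_or => /andP[].
- apply/seteqP; split=> [x hx|x Fx k _ /=]; last first.
    by rewrite big1 // => j _; rewrite u0 // subr0.
  have Vx k : V k x.
    apply: contrapT => nVx; have := hx k I; rewrite /= big_ord_recr /=.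
    have -> : u k x = 1 by apply: (@Urysohn_sub1 T R F (~` V k) (sep k)); exists x.
    by rewrite subrr mulr0 ltxx.
  apply: cF => B; rewrite -nbhs_entourageE => -[E entE EB].
  have [k fkE] := fE _ (entourage_inv entE).
  have [y Fy /xsectionP fyx] := Vx k; exists y; split => //.
  by apply: EB; apply/xsectionP; exact: (fkE (y, x)).
Qed.

(** [h k] lies between the indicators of [F] and of [W k], and [mu (W k)] decreases to [mu F], so
    testing weak convergence on a single [h k] suffices. *)
Lemma portmanteau_closed (mu_ : nat -> M1) (mu : M1) (F : set T) (e : R) :
  countable_uniformity T ->
  (forall f : T -> R, continuous f -> bounded_fun f ->
    (\int[mu_ n]_x (f x)%:E)%E @[n --> \oo] --> (\int[mu]_x (f x)%:E)%E) ->
  closed F -> 0 < e -> \forall n \near \oo, (mu_ n F <= mu F + e%:E)%E.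
Proof.
move=> cT wc cF e0; have [h [ch h01 h1 hS hF]] := closed_zero_sets cT cF.
pose W k := [set x | 0 < h k x].
have oW k : open (W k).
  have -> : W k = h k @^-1` `]0, +oo[.
    by apply/seteqP; split=> x /=; rewrite in_itv /= andbT.
  by have /continuousP := ch k; apply; exact: interval_open.
have mW k : measurable (W k : set (borel T)) by exact: open_borel.
have mF : measurable (F : set (borel T)) by exact: closed_borel.
have mh k := continuous_borel (ch k).
have Wcvg : mu (W k) @[k --> \oo] --> mu F.
  rewrite -hF; apply: nonincreasing_cvg_mu => //.
  - by rewrite ltey_eq fin_num_measure.
  - by rewrite hF.
  - by apply/nonincreasing_seqP => k; apply/subsetPset => x; exact: hS.
have fF : mu F \is a fin_num by rewrite fin_num_measure.
have ltFe : (mu F < mu F + (e / 2)%:E)%E by rewrite lteDl // lte_fin divr_gt0.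
have [k Wk] : exists k, (mu (W k) < mu F + (e / 2)%:E)%E.
  have [N _ /(_ N (leqnn N))] := Wcvg _ (open_ereal_lt' ltFe).
  by exists N.
have ih (nu : M1) : (nu F <= \int[nu]_x (h k x)%:E <= nu (W k))%E.
  have iE A : measurable (A : set (borel T)) -> nu A = (\int[nu]_x (\1_A x)%:E)%E.
    by move=> mA; rewrite integral_indic // setIT.
  rewrite (iE _ mF) (iE _ (mW k)); apply/andP; split.
    apply: ge0_le_integral => //.
    - exact/measurable_EFinP.
    - exact/measurable_EFinP.
    - move=> x _; rewrite lee_fin indicE; case: (boolP (x \in F)) => [|_].
        by rewrite inE => /(h1 k) ->.
      by have /andP[] := h01 k x.
  apply: ge0_le_integral => //.
  - by move=> x _; rewrite lee_fin; have /andP[] := h01 k x.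
  - exact/measurable_EFinP.
  - exact/measurable_EFinP.
  - move=> x _; rewrite lee_fin indicE; have /andP[h2 h3] := h01 k x.
    case: (boolP (x \in W k)) => // /negP; rewrite inE /W /= => /negP.
    by rewrite -leNgt.
have bh : bounded_fun (h k).
  exists 1; split; first exact: num_real.
  move=> M M1' x _ /=; have /andP[h0 h1'] := h01 k x.
  by rewrite ger0_norm // (le_trans h1') // ltW.
have lt1 : (\int[mu]_x (h k x)%:E < mu F + e%:E)%E.
  have /andP[_ /le_lt_trans] := ih mu; apply; apply: lt_trans Wk _.
  by rewrite lteD2lE // lte_fin ltr_pdivrMr //; lra.
have near_lt : \forall n \near \oo, (\int[mu_ n]_x (h k x)%:E < mu F + e%:E)%E.
  exact: (wc _ (ch k) bh _ (open_ereal_lt' lt1)).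
near=> n; apply: (@le_trans _ _ (\int[mu_ n]_x (h k x)%:E)%E).
  by have /andP[] := ih (mu_ n).
by apply: ltW; near: n.
Unshelve. all: by end_near. Qed.

End portmanteau_closed.

(** * Prohorov's theorem *)

Lemma open_setD (T : topologicalType) (G F : set T) :
  open G -> closed F -> open (G `\` F).
Proof. by move=> oG cF; rewrite setDE; apply: openI => //; exact: closed_openC. Qed.

(* The limits [alpha] on finite unions of compact pieces determine the limit
   measure on open sets by inner approximation ([beta]); the induced outer
   measure is additive across closed sets, so Borel sets are Caratheodory
   measurable for it (Billingsley's proof). *)
Section limit_measure.
Context {R : realType} {T : ptopologicalType}.
Local Notation M1 := (probability (borel T) R).
Variables (B : nat -> set T) (mu_ : nat -> M1) (alpha : seq nat -> R).

Definition pieces (s : seq nat) : set T := \big[setU/set0]_(j <- s) B j.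

Hypothesis closedB : forall j, closed (B j).
Hypothesis alphaP : forall s, fine (mu_ n (pieces s)) @[n --> \oo] --> alpha s.
(** This combines compactness of the pieces with the base property; it is what makes [beta]
    countably subadditive on open sets. *)
Hypothesis covering : forall s (G : nat -> set T), (forall n, open (G n)) ->
  pieces s `<=` \bigcup_n G n ->
  exists N (t : nat -> seq nat), pieces s `<=` \bigcup_(n < N) pieces (t n) /\
    forall n, pieces (t n) `<=` G n.
Hypothesis tight : forall e : R, 0 < e ->
  exists s, forall n, (1 - e%:E <= mu_ n (pieces s))%E.

Lemma pieces_cat s t : pieces (s ++ t) = pieces s `|` pieces t.
Proof. by rewrite /pieces big_cat. Qed.

Lemma pieces_closed s : closed (pieces s).
Proof.
elim: s => [|j s ih]; first by rewrite /pieces big_nil; exact: closed0.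
by rewrite /pieces big_cons; apply: closedU.
Qed.

Let mpieces s : measurable (pieces s : set (borel T)).
Proof. by apply: closed_borel; exact: pieces_closed. Qed.

Let fpieces n s : mu_ n (pieces s) = (fine (mu_ n (pieces s)))%:E.
Proof. by rewrite fineK // fin_num_measure. Qed.

Let alpha_le s t : pieces s `<=` pieces t -> alpha s <= alpha t.
Proof.
move=> st; apply: (ler_cvg_to (@alphaP s) (@alphaP t)).
apply: nearW => n; rewrite -lee_fin -!fpieces.
by apply: le_measure => //; rewrite inE.
Qed.

Let alpha_nil : alpha [::] = 0.
Proof.
have := @alphaP [::]; rewrite /pieces big_nil.
under eq_fun do rewrite measure0.
by move=> /cvg_unique; apply=> //; exact: cvg_cst.
Qed.

Let alpha_le1 s : alpha s <= 1.
Proof.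
apply: (ler_cvg_to (@alphaP s) (@cvg_cst _ _ _ _ _)).
by apply: nearW => n; rewrite -lee_fin -fpieces; exact: probability_le1.
Qed.

Let alpha_catU s t : alpha (s ++ t) <= alpha s + alpha t.
Proof.
apply: (ler_cvg_to (@alphaP _) (cvgD (@alphaP s) (@alphaP t))).
apply: nearW => n; rewrite -lee_fin EFinD -!fpieces pieces_cat.
exact: measureU2.
Qed.

Let alpha_cat s t : pieces s `&` pieces t = set0 ->
  alpha (s ++ t) = alpha s + alpha t.
Proof.
move=> st; have := @alphaP (s ++ t).
rewrite (_ : (fun n => _) =
    (fun n => fine (mu_ n (pieces s)) + fine (mu_ n (pieces t)))).
  by move=> /cvg_unique; apply=> //; exact: cvgD (@alphaP s) (@alphaP t).
apply/funext => n; apply/EFin_inj; rewrite EFinD -!fpieces pieces_cat.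
by rewrite measureU.
Qed.

Let beta (G : set T) : \bar R :=
  ereal_sup [set (alpha s)%:E | s in [set s | pieces s `<=` G]].

Let le_alpha_beta s G : pieces s `<=` G -> ((alpha s)%:E <= beta G)%E.
Proof. by move=> sG; apply: ereal_sup_ubound; exists s. Qed.

Let beta_le1 G : (beta G <= 1)%E.
Proof. by apply: ge_ereal_sup => _ [s _ <-]; rewrite lee_fin. Qed.

Let beta_ge0 G : (0 <= beta G)%E.
Proof.
by rewrite -[0%E]/(0%:E) -alpha_nil; apply: le_alpha_beta; rewrite /pieces big_nil.
Qed.

Let beta_le G G' : G `<=` G' -> (beta G <= beta G')%E.
Proof.
move=> GG'; apply: ge_ereal_sup => _ [s sG <-].
by apply: le_alpha_beta; exact: subset_trans GG'.
Qed.

Let beta_fin G : beta G \is a fin_num.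
Proof. by rewrite ge0_fin_numE // (le_lt_trans (beta_le1 _)) // ltry. Qed.

Let beta_sub G (F : nat -> set T) : (forall n, open (F n)) -> G `<=` \bigcup_n F n ->
  (beta G <= \sum_(n <oo) beta (F n))%E.
Proof.
move=> oF GF; apply: ge_ereal_sup => _ [s sG <-].
have [N [t [st tF]]] := covering oF (subset_trans sG GF).
apply: (@le_trans _ _ (\sum_(0 <= n < N) beta (F n))%E); last first.
  by apply: nneseries_lim_ge => n _ _.
have H : pieces s `<=` pieces (flatten (mkseq t N)).
  move=> x /st[n /= nN tx]; have -> : pieces (flatten (mkseq t N)) =
      \big[setU/set0]_(0 <= n < N) pieces (t n).
    by rewrite /pieces big_flatten /= big_map /index_iota subn0.
  by rewrite big_mkord -(bigcup_mkord N (fun n => pieces (t n))); exists n.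
apply: (@le_trans _ _ (alpha (flatten (mkseq t N)))%:E).
  by rewrite lee_fin; exact: alpha_le.
apply: (@le_trans _ _ (\sum_(0 <= n < N) alpha (t n))%:E).
  rewrite lee_fin /mkseq /index_iota subn0.
  elim: (iota 0 N) => [|n r ih] /=; first by rewrite big_nil alpha_nil.
  by rewrite big_cons; apply: le_trans (alpha_catU _ _) _; rewrite lerD2l.
by rewrite -sumEFin; apply: lee_sum => n _; exact: le_alpha_beta.
Qed.

Definition limit_outer (M : set T) : \bar R :=
  ereal_inf [set beta G | G in [set G | open G /\ M `<=` G]].

Let gamma := limit_outer.

Let gamma_le M G : open G -> M `<=` G -> (gamma M <= beta G)%E.
Proof. by move=> oG MG; apply: ereal_inf_lbound; exists G. Qed.

Let gamma_open G : open G -> gamma G = beta G.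
Proof.
move=> oG; apply/eqP; rewrite eq_le gamma_le //=.
by apply: le_ereal_inf_tmp => _ [G' [_ GG'] <-]; exact: beta_le.
Qed.

Let gamma0 : gamma set0 = 0%E.
Proof.
rewrite gamma_open; last exact: open0.
apply/eqP; rewrite eq_le beta_ge0 andbT.
apply: ge_ereal_sup => _ [s s0 <-]; rewrite lee_fin -alpha_nil; apply: alpha_le.
by apply: subset_trans s0 _.
Qed.

Let gamma_ge0 M : (0 <= gamma M)%E.
Proof. by apply: le_ereal_inf_tmp => _ [G _ <-]. Qed.

Let gamma_fin M : gamma M \is a fin_num.
Proof.
rewrite ge0_fin_numE //; apply: le_lt_trans (ltry 1).
by apply: le_trans (beta_le1 setT); apply: gamma_le => //; exact: openT.
Qed.

Let gamma_sub M F : subset_sigma_subadditive gamma M F.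
Proof.
move=> MF; apply/lee_addgt0Pr => e e0.
apply: le_trans (epsilon_trick _ _ (ltW e0)) => //.
have /choice[G GP] : forall n, exists G, [/\ open G, F n `<=` G &
    (beta G <= gamma (F n) + (e / (2 ^ n.+1)%:R)%:E)%E].
  move=> n; have en : 0 < e / (2 ^ n.+1)%:R by rewrite divr_gt0 // ltr0n expn_gt0.
  have [_ [G [oG FG] <-] lt] := lb_ereal_inf_adherent en (gamma_fin (F n)).
  by exists G; split => //; exact: ltW.
apply: (@le_trans _ _ (\sum_(n <oo) beta (G n))%E).
  have oG n : open (G n) by have [] := GP n.
  have oU : open (\bigcup_n G n) by exact: bigcup_open.
  apply: le_trans (beta_sub oG (@subset_refl _ _)).
  apply: gamma_le => //; apply: subset_trans MF _.
  by apply: subset_bigcup => n _; have [] := GP n.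
by apply: lee_nneseries => n _ //; have [] := GP n.
Qed.

HB.instance Definition _ :=
  isSubsetOuterMeasure.Build R T limit_outer gamma0 gamma_ge0 gamma_sub.

(** Given an open [G] containing [X], pick [pieces s1] inside [G] minus [F], then [pieces s0] inside
    the open set [G] minus [pieces s1], which contains the part of [G] in [F]. The two unions are
    disjoint, so their [alpha] values add up to at most [beta G]. *)
Let gamma_closed F : closed F -> limit_outer.-caratheodory F.
Proof.
move=> cF; apply: le_caratheodory_measurable => X.
apply: le_ereal_inf_tmp => _ [G [oG XG] <-].
have oGF : open (G `\` F) by apply: open_setD.
have h1 : (gamma (X `&` F) <= gamma (G `&` F))%E by apply: le_outer_measure; exact: setSI.
have h2 : (gamma (X `&` ~` F) <= beta (G `\` F))%E.
  by apply: gamma_le => //; exact: setSI.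
apply: le_trans (leeD h1 h2) _.
rewrite -leeBrDl //; apply: ge_ereal_sup => _ [s1 sGF <-].
rewrite leeBrDl // -leeBrDr //.
have o1 : open (G `\` pieces s1) by apply: open_setD => //; exact: pieces_closed.
apply: (@le_trans _ _ (beta (G `\` pieces s1))).
  apply: gamma_le => // x [Gx Fx]; split => // s1x.
  by have [_] := sGF _ s1x; exact.
apply: ge_ereal_sup => _ [s0 sGs <-].
rewrite leeBrDr // -EFinD -alpha_cat.
  apply: le_alpha_beta; rewrite pieces_cat subUset; split.
    by move=> x /sGs[].
  by move=> x /sGF[].
by rewrite -subset0 => x [/sGs[]].
Qed.

Let gamma_borel (A : set (borel T)) : measurable A -> limit_outer.-caratheodory A.
Proof.
move: A; apply: smallest_sub => [|A oA].
  exact: (sigma_algebra_measurable (caratheodory_type limit_outer)).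
rewrite -[A]setCK; apply: caratheodory_measurable_setC; apply: gamma_closed.
exact: open_closedC.
Qed.

Let nu (A : set (borel T)) := limit_outer A.

Let nu_sigma_additive : semi_sigma_additive nu.
Proof.
move=> F mF tF mUF.
apply: (@caratheodory_measure_sigma_additive R T limit_outer F) => //.
- by move=> n; apply: gamma_borel.
- exact: gamma_borel.
Qed.

HB.instance Definition _ := isMeasure.Build _ (borel T) R nu
  gamma0 gamma_ge0 nu_sigma_additive.

Let nu_setT : nu setT = 1%E.
Proof.
rewrite /nu -/gamma gamma_open; last exact: openT.
apply/eqP; rewrite eq_le beta_le1 /=.
apply/lee_addgt0Pr => e e0; have [s sP] := tight e0.
apply: (@le_trans _ _ ((alpha s)%:E + e%:E)%E); last by rewrite leeD2r // le_alpha_beta.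
rewrite -EFinD lee_fin -lerBlDr.
apply: (ler_cvg_to (@cvg_cst _ _ _ _ _) (@alphaP s)).
by apply: nearW => n; rewrite -lee_fin -fpieces EFinB.
Qed.

HB.instance Definition _ := Measure_isProbability.Build _ _ _ nu nu_setT.

Lemma limit_measure_exists : exists mu : M1, forall (G : set T) (e : R), open G ->
  0 < e -> \forall n \near \oo, (mu G <= mu_ n G + e%:E)%E.
Proof.
exists nu => G e oG e0.
have e2 : 0 < e / 2 by rewrite divr_gt0.
have -> : (nu : M1) G = beta G by rewrite -gamma_open.
have [_ [s sG <-] lt] := ub_ereal_sup_adherent e2 (beta_fin G).
have lts : alpha s - e / 2 < alpha s by rewrite ltrBlDr ltrDl.
have near_s : \forall n \near \oo, alpha s - e / 2 < fine (mu_ n (pieces s)).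
  exact: (cvgr_gt _ (@alphaP s) _ lts).
near=> n.
have h : alpha s - e / 2 < fine (mu_ n (pieces s)) by near: n.
apply: (@le_trans _ _ (alpha s + e / 2)%:E).
  by rewrite EFinD -leeBlDr // ltW.
apply: (@le_trans _ _ (mu_ n (pieces s) + e%:E)%E).
  by rewrite fpieces -EFinD lee_fin; lra.
rewrite leeD2r //; apply: le_measure; rewrite ?inE //; exact: open_borel.
Unshelve. all: by end_near. Qed.

End limit_measure.

Section prohorov.
Context {R : realType} {T : ptopologicalType}.
Local Notation M1 := (probability (borel T) R).
Variables (A K : nat -> set T) (mu_ : nat -> M1).
Hypothesis openA : forall i, open (A i).
Hypothesis closedK : forall k, closed (K k).
Hypothesis compactK : forall k (u : nat -> T), (forall n, K k (u n)) ->
  exists2 phi, increasing_seq phi & exists l : T, u \o phi @ \oo --> l.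
Hypothesis baseA : forall k x G, K k x -> open G -> G x ->
  exists i, A i x /\ closure (A i) `<=` G.
Hypothesis tightK : forall e : R, 0 < e ->
  exists k, forall n, (1 - e%:E <= mu_ n (K k))%E.

(** Cutting by [K ik.2] makes the closures of basic sets compact; unpickling turns pairs of indices
    into one index. *)
Let B (j : nat) : set T :=
  if choice.unpickle j is Some ik then closure (A ik.1) `&` K ik.2 else set0.

Let closedB j : closed (B j).
Proof.
rewrite /B; case: choice.unpickle => [ik|]; last exact: closed0.
by apply: closedI => //; exact: closed_closure.
Qed.

Let pieces_mem s x : pieces B s x <-> exists2 j, j \in s & B j x.
Proof. by rewrite /pieces -bigcup_seq; split=> -[j]; exists j. Qed.

(** Sequential compactness is enough because the [A j] are countably many: points of [C] avoiding
    the first [m] good sets, for every [m], would have a limit in [C], and that limit lies in some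
    good [A j]. *)
Let cover1 k C (G : nat -> set T) : closed C -> C `<=` K k ->
  (forall n, open (G n)) -> C `<=` \bigcup_n G n ->
  exists N (t : nat -> seq nat), C `<=` \bigcup_(n < N) pieces B (t n) /\
    forall n, pieces B (t n) `<=` G n.
Proof.
move=> cC CK oG CG.
pose good j := exists n, closure (A j) `<=` G n.
have [m Cm] : exists m, forall x, C x -> exists2 j, (j < m)%N & good j /\ A j x.
  apply: contrapT => /forallNP nC.
  have /choice[u uP] : forall m, exists x, C x /\
      forall j, (j < m)%N -> good j -> ~ A j x.
    move=> m; have /existsNP[x /not_implyP[Cx nx]] := nC m.
    by exists x; split => // j jm gj Ax; apply: nx; exists j.
  have [|phi phii [l ul]] := @compactK k u; first by move=> n; apply: CK; have [] := uP n.
  have Cl : C l.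
    apply: (closed_cvg C cC _ _ ul); apply: nearW => n.
    by have [] := uP (phi n).
  have [n _ Gl] := CG _ Cl.
  have [j [Aj AG]] := baseA (CK _ Cl) (oG n) Gl.
  have [N _ HN] := ul _ (open_nbhs_nbhs (conj (openA j) Aj)).
  (* This index is past the entrance of the subsequence into [A j], and its image under [phi]
     exceeds [j]. *)
  have [_ /(_ j)] := uP (phi (N + j.+1)%N); apply.
  - exact: leq_trans (leq_addl _ _) (increasing_seq_le phii _).
  - by exists n.
  - by apply: HN => /=; rewrite leq_addr.
have /choice[sel selP] : forall j, exists n, good j -> closure (A j) `<=` G n.
  move=> j; have [[n gn]|ng] := pselect (good j); first by exists n.
  by exists 0%N.
exists (\max_(j < m) sel j).+1.
(* [t n] gathers the good indices that [sel] sends to [n], so that its pieces lie in [G n]. *)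
exists (fun n => [seq choice.pickle (j, k) | j <- iota 0 m & `[< good j >] && (sel j == n)]).
split=> [x Cx|n x /pieces_mem[_ /mapP[j + ->]]].
  have [j jm [gj Ajx]] := Cm _ Cx.
  exists (sel j); first by rewrite /= ltnS; exact: (leq_bigmax (Ordinal jm)).
  apply/pieces_mem; exists (choice.pickle (j, k)).
    apply/mapP; exists j => //; rewrite mem_filter mem_iota /= add0n jm eqxx !andbT.
    exact/asboolP.
  by rewrite /B choice.pickleK /=; split; [exact: subset_closure | exact: CK].
rewrite mem_filter => /andP[/andP[/asboolP gj /eqP <-] _].
by rewrite /B choice.pickleK /= => -[+ _]; exact: selP.
Qed.

Let covering s (G : nat -> set T) : (forall n, open (G n)) ->
  pieces B s `<=` \bigcup_n G n ->
  exists N (t : nat -> seq nat), pieces B s `<=` \bigcup_(n < N) pieces B (t n) /\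
    forall n, pieces B (t n) `<=` G n.
Proof.
move=> oG; elim: s => [_|j s ih].
  by exists 0%N, (fun=> [::]); split=> [x|n x]; rewrite /pieces big_nil.
rewrite {1 2}/pieces big_cons -/(pieces B s) subUset => -[jG /ih[N [t [st tG]]]].
have [N' [t' [st' tG']]] : exists N (t : nat -> seq nat),
    B j `<=` \bigcup_(n < N) pieces B (t n) /\ forall n, pieces B (t n) `<=` G n.
  move: jG; rewrite {1 2}/B; case: (choice.unpickle j) => [[i k]|] /=.
    move=> jG; apply: (@cover1 k _ G _ _ oG jG); last by move=> x [].
    by apply: closedI => //; exact: closed_closure.
  by move=> _; exists 0%N, (fun=> [::]); split=> [x|n x] //; rewrite /pieces big_nil.
exists (maxn N' N), (fun n => t' n ++ t n); split=> [x|n]; last first.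
  by rewrite pieces_cat subUset.
move=> [/st'|/st] -[n /= nN tx]; exists n; rewrite ?pieces_cat.
- by rewrite /= leq_max nN.
- by left.
- by rewrite /= leq_max nN orbT.
- by right.
Qed.

Let tight (e : R) : 0 < e -> exists s, forall n, (1 - e%:E <= mu_ n (pieces B s))%E.
Proof.
move=> /tightK[k kP].
(* With every [G n] the whole space, this only says that finitely many pieces cover [K k]. *)
have [|N [t [Kt _]]] := @cover1 k (K k) (fun=> setT) (@closedK k) (@subset_refl _ _) (fun=> openT).
  by move=> x _; exists 0%N.
exists (flatten (mkseq t N)) => n; apply: le_trans (kP n) _.
apply: le_measure; rewrite ?inE; [exact: closed_borel | | ].
  by apply: closed_borel; exact: pieces_closed.
move=> x /Kt[i /= iN /pieces_mem[j jt Bj]]; apply/pieces_mem; exists j => //.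
by apply/flattenP; exists (t i) => //; apply/mapP; exists i; rewrite ?mem_iota.
Qed.

(** Finite lists of indices are countable, so a diagonal subsequence makes the mass of every finite
    union of pieces converge; numbers coding no list impose no condition. *)
Lemma prohorov : exists2 phi, increasing_seq phi & exists mu : M1,
  forall f : T -> R, continuous f -> bounded_fun f ->
    (\int[mu_ (phi n)]_x (f x)%:E)%E @[n --> \oo] --> (\int[mu]_x (f x)%:E)%E.
Proof.
pose a s n := fine (mu_ n (pieces B s)).
have mp s : measurable (pieces B s : set (borel T)).
  by apply: closed_borel; exact: pieces_closed.
have a01 s n : 0 <= a s n <= 1.
  rewrite -!lee_fin /a fineK ?fin_num_measure // measure_ge0 /=.
  exact: probability_le1.
pose P i (phi : nat -> nat) := if choice.unpickle i is Some s then cvgn (a s \o phi) else True.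
have P1 i phi : increasing_seq phi -> exists2 th, increasing_seq th & P i (phi \o th).
  move=> phii; rewrite /P; case: choice.unpickle => [s|]; last by exists id.
  have [|th thi thc] := @bolzano_weierstrass R (a s \o phi); last by exists th.
  exists 1; split; first exact: num_real.
  move=> M M1' n _ /=; have /andP[h0 h1] := a01 s (phi n).
  by rewrite ger0_norm // (le_trans h1) // ltW.
have P2 i phi psi m : P i phi ->
    (exists2 th, increasing_seq th & forall n, psi (n + m)%N = phi (th n)) -> P i psi.
  rewrite /P; case: choice.unpickle => [s|//] /cvg_ex[l al] [th thi psiE].
  apply/cvg_ex; exists l; rewrite -(cvg_shiftn m).
  rewrite (_ : (fun n => _) = (a s \o phi) \o th); last first.
    by apply/funext => n /=; rewrite psiE.
  exact: cvg_subsequence al.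
have [phi phii phiP] := diagonal_subsequence P1 P2.
exists phi => //.
have [||mu muP] := @limit_measure_exists R T B (mu_ \o phi)
  (fun s => limn (a s \o phi)) closedB _ covering.
- by move=> s; have := phiP (choice.pickle s); rewrite /P choice.pickleK.
- by move=> e /tight[s sP]; exists s => n; exact: sP.
by exists mu => f cf bf; exact: (portmanteau_open (mu_ := mu_ \o phi)).
Qed.

End prohorov.

(** * Compactness of curves *)

Lemma within_continuous_mdistP (R : realType) (X : metricType R) (A : set R) (f : R -> X) :
  {within A, continuous f} <-> forall x e, A x -> 0 < e ->
    exists2 d, 0 < d & forall y, A y -> `|x - y| < d -> mdist (f x) (f y) < e.
Proof.
split=> [/subspace_continuousP cf x e Ax e0|H].
  have /metricType_numDomainType.cvgrPdist_lt/(_ e e0) := cf x Ax.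
  by move=> /nbhs_ballP[d /= d0 dP]; exists d => // y Ay xy; exact: dP.
apply/subspace_continuousP => x Ax.
apply/metricType_numDomainType.cvgrPdist_lt => e e0; have [d d0 dP] := H x e Ax e0.
by apply/nbhs_ballP; exists d => //= y xy Ay; exact: dP.
Qed.

Lemma cvg_mdistP (R : realType) (X : metricType R) (u : nat -> X) (l : X) :
  u @ \oo --> l <-> forall e, 0 < e -> exists N, forall n, (N <= n)%N -> mdist l (u n) < e.
Proof.
split=> [/metricType_numDomainType.cvgrPdist_lt cu e e0|H].
  by have [N _ HN] := cu e e0; exists N => n Nn; exact: HN.
apply/metricType_numDomainType.cvgrPdist_lt => e e0.
by have [N HN] := H e e0; exists N.
Qed.

Section geometric.
Context {R : realType} {X : metricType R}.

(** The bound is the exact geometric sum, which is the form that passes through the induction on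
    [k]. *)
Lemma mdist_geometric (u : nat -> X) :
  (forall n, mdist (u n) (u n.+1) <= 2^-1 ^+ n) ->
  forall n k, mdist (u n) (u (n + k)%N) <= 2 * 2^-1 ^+ n - 2 * 2^-1 ^+ (n + k).
Proof.
move=> H n; elim=> [|k ih]; first by rewrite addn0 mdistxx subrr.
apply: le_trans (metric_triangle _ (u (n + k)%N) _) _.
have := H (n + k)%N; rewrite addnS exprS; move: ih; lra.
Qed.

Lemma geometric_limit (u : nat -> X) : compact [set: X] ->
  (forall n, mdist (u n) (u n.+1) <= 2^-1 ^+ n) ->
  exists l, forall n, mdist (u n) l <= 2 * 2^-1 ^+ n.
Proof.
move=> cX H.
have [//|phi phii [l _ /cvg_mdistP ul]] := @compact_cvg_subsequence R X setT u cX.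
exists l => n; apply/ler_addgt0Pl => e /ul[N HN].
have nN := leq_trans (leq_addr N n) (increasing_seq_le phii _).
have := HN (n + N)%N (leq_addl _ _); rewrite metric_sym /= => h1.
apply: le_trans (metric_triangle _ (u (phi (n + N)%N)) _) _.
have := mdist_geometric H n (phi (n + N)%N - n); rewrite subnKC //.
have : 0 <= 2^-1 ^+ phi (n + N)%N :> R by rewrite exprn_ge0.
move: h1; lra.
Qed.

End geometric.

Lemma half_expr_lt (R : realType) (e : R) : 0 < e -> exists n, 2^-1 ^+ n < e.
Proof.
move=> e0; have h : `|2^-1 : R| < 1 by rewrite ger0_norm; lra.
have /cvgrPdist_lt/(_ e e0)[N _ /(_ N (leqnn N))] := cvg_expr h.
by rewrite sub0r normrN ger0_norm ?exprn_ge0 //; exists N.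
Qed.

Lemma half_expr_le (R : realType) m n : (m <= n)%N -> 2^-1 ^+ n <= 2^-1 ^+ m :> R.
Proof. by move=> mn; apply: ler_wiXn2l => //; lra. Qed.

Section pcurve_complete.
Context {R : realType} {X : metricType R}.
Hypothesis cX : compact [set: X].

Lemma pcurve_complete (g : nat -> pcurve X) :
  (forall n, pcurve_dist (g n) (g n.+1) < 2^-1 ^+ n) ->
  exists h, forall n, pcurve_dist (g n) h <= 2 * 2^-1 ^+ n.
Proof.
move=> H.
have /choice[s sP] : forall n, exists s, increasing_homeo (g n) (g n.+1) s /\
    forall t, dom (g n) t -> mdist (g n t) (g n.+1 (s t)) < 2^-1 ^+ n.
  by move=> n; have [s] := pcurve_dist_lt (H n); exists s.
(* [S n] pulls [g n] back to the domain of [g 0]. *)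
pose S := fix S n := if n is m.+1 then s m \o S m else id.
have Sh n : increasing_homeo (g 0%N) (g n) (S n).
  elim: n => [|n ih] /=; first exact: increasing_homeo_id.
  by apply: increasing_homeo_comp ih _; have [] := sP n.
have cauchy t : dom (g 0%N) t -> forall n,
    mdist (g n (S n t)) (g n.+1 (S n.+1 t)) <= 2^-1 ^+ n.
  move=> Dt n; apply: ltW; have [_] := sP n; apply.
  exact: increasing_homeo_dom (Sh n) _ Dt.
have /choice[l lP] : forall t, exists l, dom (g 0%N) t ->
    forall n, mdist (g n (S n t)) l <= 2 * 2^-1 ^+ n.
  move=> t; have [Dt|nDt] := pselect (dom (g 0%N) t); last by exists (g 0%N t).
  by have [l lP] := geometric_limit cX (cauchy t Dt); exists l.
have cl : {within `[lo (g 0%N), hi (g 0%N)], continuous l}.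
  apply/within_continuous_mdistP => x e Dx e0.
  (* Replacing [l] by [g n \o S n] costs [2 * 2^-n < e / 4] at each of [x] and [y]; together with
     [e / 4] from the continuity of [g n \o S n] the total is below [e]. *)
  have [n ne] : exists n, 2^-1 ^+ n < e / 8 by apply: half_expr_lt; rewrite divr_gt0.
  have cG : {within dom (g 0%N), continuous (g n \o S n)}.
    apply: (within_continuous_comp_in (B := dom (g n))).
    - exact: increasing_homeo_dom (Sh n).
    - by have [] := Sh n.
    - exact: pcurve_continuous.
  have [|d d0 dP] := (within_continuous_mdistP _ _).1 cG x (e / 4) Dx.
    by rewrite divr_gt0.
  exists d => // y Dy xy; have := dP y Dy xy => /= h.
  have := lP x Dx n; have := lP y Dy n.
  have := metric_triangle (l x) (g n (S n x)) (l y).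
  have := metric_triangle (g n (S n x)) (g n (S n y)) (l y).
  rewrite (metric_sym (l x) (g n (S n x))); lra.
exists (PCurve (lo_lt_hi (g 0%N)) cl) => n; rewrite pcurve_dist_sym.
apply: (@pcurve_dist_le _ _ _ _ (S n)); first exact: Sh.
by move=> t Dt /=; rewrite metric_sym; exact: lP.
Qed.

End pcurve_complete.

(** * Gluing homeomorphisms of the line *)

Section line_homeo.
Context {R : realType}.

(** On the whole line, homeomorphisms can be glued at a point without tracking domains; the
    restriction to the interval of a curve is made only at the end. *)
Definition line_homeo (s s' : R -> R) :=
  [/\ continuous s, continuous s', cancel s s', cancel s' s & {homo s : x y / x < y}].

Lemma line_homeo_affine (a c t u : R) : a < t -> c < u ->
  exists s s', [/\ line_homeo s s', s a = c & s t = u].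
Proof.
move=> at_ cu.
have C (b m w : R) : continuous (fun x => b + (x - m) * w).
  move=> x; apply: cvgD; first exact: cvg_cst.
  by apply: cvgMl; apply: cvgB; [exact: cvg_id | exact: cvg_cst].
exists (fun x => c + (x - a) * ((u - c) / (t - a))),
       (fun y => a + (y - c) * ((t - a) / (u - c))).
split; last 2 first.
- by rewrite subrr mul0r addr0.
- by field; lra.
split; [exact: C|exact: C| | |].
- by move=> x; field; lra.
- by move=> x; field; lra.
- move=> x y xy; rewrite ltrD2l ltr_pM2r ?ltrD2r //.
  by rewrite divr_gt0; lra.
Qed.

(** When [s1 p = s2 p = q] this is [s1] to the left of [p] and [s2] to the right. The lattice
    formula makes continuity immediate, and the inverse is the same formula with [p] and [q]
    exchanged. *)
Definition glue (p q : R) (s1 s2 : R -> R) x :=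
  Num.min (s1 x) q + Num.max (s2 x) q - q.

Lemma glue_le p q s1 s2 s1' s2' x : line_homeo s1 s1' -> line_homeo s2 s2' ->
  s1 p = q -> s2 p = q -> x <= p -> glue p q s1 s2 x = s1 x.
Proof.
move=> [_ _ _ _ m1] [_ _ _ _ m2] p1 p2; rewrite le_eqVlt => /orP[/eqP ->|xp].
  by rewrite /glue p1 p2 minxx maxxx addrK.
rewrite /glue (min_idPl _) ?(max_idPr _) ?addrK //; apply: ltW.
  by rewrite -p2; exact: m2.
by rewrite -p1; exact: m1.
Qed.

Lemma glue_ge p q s1 s2 s1' s2' x : line_homeo s1 s1' -> line_homeo s2 s2' ->
  s1 p = q -> s2 p = q -> p <= x -> glue p q s1 s2 x = s2 x.
Proof.
move=> [_ _ _ _ m1] [_ _ _ _ m2] p1 p2; rewrite le_eqVlt => /orP[/eqP <-|px].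
  by rewrite /glue p1 p2 minxx maxxx addrK.
rewrite /glue (min_idPr _) ?(max_idPl _).
- by rewrite addrC addKr.
- by apply: ltW; rewrite -p2; exact: m2.
- by apply: ltW; rewrite -p1; exact: m1.
Qed.

Lemma line_homeo_sym s s' : line_homeo s s' -> line_homeo s' s.
Proof.
move=> [c c' k k' m]; split => // x y xy; rewrite ltNge le_eqVlt; apply/negP => /orP[/eqP E|L].
  by move: xy; rewrite -(k' x) -E k' ltxx.
by have := m _ _ L; rewrite !k' => /(lt_trans xy); rewrite ltxx.
Qed.

Lemma line_homeo_glue p q s1 s2 s1' s2' : line_homeo s1 s1' -> line_homeo s2 s2' ->
  s1 p = q -> s2 p = q -> line_homeo (glue p q s1 s2) (glue q p s1' s2').
Proof.
have C (P Q : R) (f k : R -> R) : continuous f -> continuous k -> continuous (glue P Q f k).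
  move=> cf ck x; apply: cvgB; last exact: cvg_cst.
  apply: cvgD.
    by apply: continuous_min; [exact: cf|exact: cvg_cst].
  by apply: continuous_max; [exact: ck|exact: cvg_cst].
have K P Q f k f' k' : line_homeo f f' -> line_homeo k k' -> f P = Q -> k P = Q ->
    cancel (glue P Q f k) (glue Q P f' k').
  move=> hf hk fP kP x.
  have [cf cf' Kf Kf' mf] := hf; have [ck ck' Kk Kk' mk] := hk.
  have f'Q : f' Q = P by rewrite -fP Kf.
  have k'Q : k' Q = P by rewrite -kP Kk.
  have hf' := line_homeo_sym hf; have hk' := line_homeo_sym hk.
  have [xP|Px] := leP x P.
    rewrite (glue_le hf hk) // (glue_le hf' hk') //.
    by move: xP; rewrite le_eqVlt => /orP[/eqP ->|/mf/ltW]; rewrite fP.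
  rewrite (glue_ge hf hk) ?ltW // (glue_ge hf' hk') //.
  by apply: ltW; rewrite -kP; exact: mk.
move=> h1 h2 p1 p2.
have [c1 c1' K1 K1' m1] := h1; have [c2 c2' K2 K2' m2] := h2.
split; [exact: C|exact: C|exact: K| |].
  apply: K (line_homeo_sym h1) (line_homeo_sym h2) _ _; first by rewrite -p1 K1.
  by rewrite -p2 K2.
move=> x y xy; have [yp|py] := leP y p.
  rewrite !(glue_le h1 h2) //; first exact: m1.
  exact: le_trans (ltW xy) yp.
have [xp|px] := leP x p; last by rewrite !(glue_ge h1 h2) ?ltW //; exact: m2.
rewrite (glue_le h1 h2) // (glue_ge h1 h2) ?ltW //.
apply: (@le_lt_trans _ _ q); last by rewrite -p2; exact: m2.
by move: xp; rewrite le_eqVlt => /orP[/eqP ->|/m1/ltW]; rewrite p1.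
Qed.

End line_homeo.

(** * Curves with the same label list are close *)

Section labelled_curves.
Context {R : realType} {X : metricType R}.

(* The interval from [a] to the last entry of [l] is cut at the entries of [l],
   each piece having its image within [d] of its label. *)
Fixpoint labelled (f : R -> X) (d a : R) (l : seq (R * X)) : Prop :=
  if l is tp :: l' then
    [/\ a < tp.1, forall x, a <= x <= tp.1 -> mdist tp.2 (f x) <= d &
        labelled f d tp.1 l']
  else True.

Lemma labelled_le_last (f : R -> X) d a l :
  labelled f d a l -> a <= last a (map fst l).
Proof. by elim: l a => //= tp l ih a [/ltW at_ _ /ih]; exact: le_trans. Qed.

(** The homeomorphism maps cut points to cut points, so corresponding pieces are within [d] of a
    common label. The point [a] is excluded because empty lists give no information there. *)
Lemma labelled_homeo (f k : R -> X) (d : R) l l' a c : map snd l = map snd l' ->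
  labelled f d a l -> labelled k d c l' ->
  exists s s', [/\ line_homeo s s', s a = c,
    s (last a (map fst l)) = last c (map fst l') &
    forall x, a < x <= last a (map fst l) -> mdist (f x) (k (s x)) <= 2 * d].
Proof.
elim: l l' a c => [|[t p] l ih] [|[u q] l'] a c //=.
  (* Any homeomorphism taking [a] to [c] will do; the second pair of points is arbitrary. *)
  move=> _ _ _; have [||s [s' [hs sa _]]] := @line_homeo_affine R a c (a + 1) (c + 1).
  - by rewrite ltrDl.
  - by rewrite ltrDl.
  exists s, s'; split => // x /andP[ax xa].
  by move: (lt_le_trans ax xa); rewrite ltxx.
move=> [<- ll'] [/= at_ ft lt_] [cu ku lu].
have [s2 [s2' [hs2 s2t s2l H2]]] := ih _ _ _ ll' lt_ lu.
have [s1 [s1' [hs1 s1a s1t]]] := line_homeo_affine at_ cu.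
have tl := labelled_le_last lt_.
exists (glue t u s1 s2), (glue u t s1' s2'); split.
- exact: line_homeo_glue.
- by rewrite (glue_le hs1 hs2) // ltW.
- by rewrite (glue_ge hs1 hs2).
move=> x /andP[ax xl]; have [xt|tx] := leP x t; last first.
  by rewrite (glue_ge hs1 hs2) //; [apply: H2; rewrite tx | exact: ltW].
rewrite (glue_le hs1 hs2) //; have [_ _ _ _ m1] := hs1.
apply: le_trans (metric_triangle _ p _) _; rewrite metric_sym.
have := ft x; rewrite (ltW ax) xt => /(_ isT).
have := ku (s1 x); rewrite -{1}s1a (ltW (m1 _ _ ax)) -s1t /=.
have -> : s1 x <= s1 t by move: xt; rewrite le_eqVlt => /orP[/eqP ->//|/m1/ltW].
by move=> /(_ isT); lra.
Qed.

Definition curve_labels (g : pcurve X) (d : R) (L : seq X) :=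
  exists2 l, labelled g d (lo g) l & map snd l = L /\ last (lo g) (map fst l) = hi g.

Lemma curve_labels_dist (g h : pcurve X) d L :
  curve_labels g d L -> curve_labels h d L -> pcurve_dist g h <= 2 * d.
Proof.
move=> [l lg [lL lasl]] [l' lh [lL' lasl']].
have [|s [s' [hs sa sl H]]] := @labelled_homeo g h d l l' (lo g) (lo h) _ lg lh.
  by rewrite lL lL'.
have [cs cs' K K' m] := hs; have [_ _ _ _ m'] := line_homeo_sym hs.
have lem : {mono s : x y / x <= y} by apply: le_mono.
rewrite lasl lasl' in sl; apply: (@pcurve_dist_le _ _ _ _ s).
  split.
  - split.
    + by move=> t; rewrite /dom /= !in_itv /= -sa -sl !lem.
    + by move=> x y _ _ xy; rewrite -(K x) xy K.
    + move=> u; rewrite /dom /= in_itv /= => /andP[hu uh]; exists (s' u); last exact: K'.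
      by rewrite /= in_itv /= -lem sa K' hu -lem sl K'.
  - by move=> x y _ _; exact: m.
  - exact: continuous_subspaceT.
  - by exists s'; [exact: continuous_subspaceT | move=> x _; exact: K].
(* At the left endpoint, not covered by [labelled_homeo], the first labels are compared directly;
   they exist because domains are nondegenerate. *)
move=> t; rewrite /dom /= in_itv /= le_eqVlt => /andP[/orP[/eqP <-|at_] tb]; last first.
  by apply: H; rewrite at_ lasl.
have := lo_lt_hi g; have := lo_lt_hi h.
case: l l' lg lh lL lL' lasl lasl' {H} => [|[t1 p1] l] [|[t2 p2] l'] /=.
- by move=> _ _ _ _ ->; rewrite ltxx.
- by move=> _ _ <-.
- by move=> _ _ <-.
move=> [at1 f1 _] [at2 f2 _] <- [E _] _ _ _ _; rewrite E in f2.
apply: le_trans (metric_triangle _ p1 _) _; rewrite metric_sym sa.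
have h1 : mdist p1 (g (lo g)) <= d by apply: f1; rewrite lexx ltW.
have h2 : mdist p1 (h (lo h)) <= d by apply: f2; rewrite lexx ltW.
lra.
Qed.

Lemma finite_seqs (F : set X) (N : nat) : finite_set F ->
  finite_set [set s : seq X | (size s <= N)%N /\ forall x, x \in s -> F x].
Proof.
move=> fF; elim: N => [|N ih].
  apply: sub_finite_set (finite_set1 [::]) => s /= [].
  by rewrite leqn0 size_eq0 => /eqP.
apply: (@sub_finite_set _ _ ([set [::]] `|` [set xs.1 :: xs.2 | xs in F `*`
    [set s : seq X | (size s <= N)%N /\ forall x, x \in s -> F x]])).
  move=> [|x s] [/= sN sF]; [by left | right].
  exists (x, s) => //=; split; first by apply: sF; rewrite mem_head.
  by split=> // y ys; apply: sF; rewrite inE ys orbT.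
rewrite finite_setU; split; first exact: finite_set1.
by apply: finite_image; apply: finite_setX.
Qed.

Hypothesis cX : compact [set: X].

Lemma pcurve_subsequence (g : nat -> pcurve X) :
  (forall d : R, 0 < d -> exists (N : nat) (F : set X), finite_set F /\
    forall n, exists2 L, curve_labels (g n) d L &
      (size L <= N)%N /\ forall x, x \in L -> F x) ->
  exists2 phi, increasing_seq phi & exists h, forall e, 0 < e ->
    exists N, forall n, (N <= n)%N -> pcurve_dist (g (phi n)) h < e.
Proof.
move=> H.
pose P k (phi : nat -> nat) := exists m, forall i j, (m <= i)%N -> (m <= j)%N ->
  pcurve_dist (g (phi i)) (g (phi j)) < 2^-1 ^+ k.
have P1 k phi : increasing_seq phi -> exists2 th, increasing_seq th & P k (phi \o th).
  (* Equal labels at this scale give distance at most [2 * (2^-k / 4)], which is below [2^-k]. *)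
  move=> phii; have [|N [F [fF HF]]] := H (2^-1 ^+ k / 4); first by rewrite divr_gt0 // exprn_gt0.
  have /choice[L LP] : forall n, exists L, curve_labels (g (phi n)) (2^-1 ^+ k / 4) L /\
      ((size L <= N)%N /\ forall x, x \in L -> F x).
    by move=> n; have [L] := HF (phi n); exists L.
  have [|th thi [L0 thL]] := @finite_range_constant_subsequence _ L.
    apply: sub_finite_set (finite_seqs N fF) => _ [n _ <-].
    by have [] := LP n.
  exists th => //; exists 0%N => i j _ _.
  have [Li _] := LP (th i); have [Lj _] := LP (th j).
  rewrite thL in Li; rewrite thL in Lj.
  apply: le_lt_trans (curve_labels_dist Li Lj) _.
  have : 0 < 2^-1 ^+ k :> R by rewrite exprn_gt0.
  lra.
have P2 k phi psi m : P k phi ->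
    (exists2 th, increasing_seq th & forall n, psi (n + m)%N = phi (th n)) -> P k psi.
  move=> [N HN] [th thi psiE]; exists (N + m)%N => i j Ni Nj.
  have mi : (m <= i)%N by apply: leq_trans Ni; rewrite leq_addl.
  have mj : (m <= j)%N by apply: leq_trans Nj; rewrite leq_addl.
  rewrite -(subnK mi) -(subnK mj) !psiE; apply: HN.
    by apply: leq_trans (increasing_seq_le thi _); rewrite leq_subRL // addnC.
  by apply: leq_trans (increasing_seq_le thi _); rewrite leq_subRL // addnC.
have [phi phii phiP] := diagonal_subsequence P1 P2.
(* Thinning once more gives consecutive distances below [2^-k], as [pcurve_complete] requires. *)
have [k n|psi psii psiP] := @frequently_subsequence (fun k p =>
    forall i, (p <= i)%N -> pcurve_dist (g (phi p)) (g (phi i)) < 2^-1 ^+ k).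
  have [m mP] := phiP k; exists (maxn n m); first exact: leq_maxl.
  by move=> i mi; apply: mP; [exact: leq_maxr | apply: leq_trans mi; exact: leq_maxr].
have [|h hP] := @pcurve_complete R X cX (g \o phi \o psi).
  move=> n /=; apply: psiP; apply: ltnW.
  by have /increasing_seqP := psii; exact.
exists (phi \o psi); first exact: increasing_seq_comp.
exists h => e e0; have [N Ne] : exists n, 2^-1 ^+ n < e / 2.
  by apply: half_expr_lt; rewrite divr_gt0.
exists N => n Nn; apply: le_lt_trans (hP n) _.
have := half_expr_le R Nn.
move: Ne; lra.
Qed.

End labelled_curves.

(** * Crossings of annuli *)

Section counting.
Context {R : realType} {T : choiceType}.
Implicit Types (A : set T) (s : seq T).

Lemma counting_ge A s : uniq s -> (forall z, z \in s -> A z) ->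
  ((size s)%:R%:E <= counting A :> \bar R)%E.
Proof.
move=> us sA; rewrite /counting; case: asboolP => [fA|_]; last by rewrite leey.
rewrite lee_fin ler_nat (_ : size s = #|` [fset z in s]%fset|); last first.
  by rewrite card_fseq undup_id.
apply: fsubset_leq_card; apply/fsubsetP => z; rewrite !inE => /sA Az.
by rewrite in_fset_set //; exact: mem_set.
Qed.

Lemma counting_geP A n : (n%:R%:E <= counting A :> \bar R)%E ->
  exists s, [/\ uniq s, size s = n & forall z, z \in s -> A z].
Proof.
move=> nA; suff [B BA nB] : exists2 B : {fset T}, [set` B] `<=` A & (n <= #|` B|)%N.
  exists (take n (enum_fset B)); split; first by rewrite take_uniq // fset_uniq.
    by rewrite size_takel.
  by move=> z /mem_take zB; apply: BA.
move: nA; rewrite /counting; case: asboolP => [fA|iA _].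
  rewrite lee_fin ler_nat => nA; exists (fset_set A) => //.
  by move=> z /=; rewrite in_fset_set // => /set_mem.
exact: infinite_set_fset.
Qed.

Lemma pigeonhole_count (X : eqType) (F : seq X) (f : T -> X) s m :
  (forall z, z \in s -> f z \in F) ->
  (forall p, p \in F -> (count (fun z => f z == p) s <= m)%N) -> (size s <= size F * m)%N.
Proof.
elim: F s => [|p F ih] s sF cF.
  by case: s sF {cF} => // z s /(_ z (mem_head _ _)).
rewrite /= mulSn -(count_predC (fun z => f z == p) s) leq_add ?cF ?mem_head //.
rewrite -size_filter; apply: ih => [z|q qF].
  by rewrite mem_filter => /andP[/= zp /sF]; rewrite inE (negbTE zp).
rewrite count_filter; apply: leq_trans (cF q _); last by rewrite inE qF orbT.
by apply: sub_count => z /= /andP[].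
Qed.

End counting.

(** * First and last hitting times of a level *)

Section hitting.
Context {R : realType}.
Implicit Types (f : R -> R) (a b c : R).

(** In this form continuity passes to subintervals, reflected time and opposite sign by
    substitution. *)
Definition eps_continuous f a b := forall t e, a <= t <= b -> 0 < e ->
  exists2 d, 0 < d & forall y, a <= y <= b -> `|t - y| < d -> `|f t - f y| < e.

Lemma eps_continuousS f a b a' b' : a <= a' -> b' <= b ->
  eps_continuous f a b -> eps_continuous f a' b'.
Proof.
move=> aa bb H t e /andP[t1 t2] e0; have [|d d0 dP] := H t e _ e0.
  by rewrite (le_trans aa) //= (le_trans t2).
exists d => // y /andP[y1 y2]; apply: dP.
by rewrite (le_trans aa) //= (le_trans y2).
Qed.

Lemma first_hit f a b c : a <= b -> eps_continuous f a b -> f a <= c -> c <= f b ->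
  exists t, [/\ a <= t <= b, f t = c & forall s, a <= s -> s < t -> f s < c].
Proof.
move=> ab cf fac cfb; pose S := [set t | a <= t <= b /\ c <= f t].
have Sb : S b by split => //; rewrite ab lexx.
have iS : has_inf S.
  by split; [exists b | exists a => t [/andP[]]].
pose t := inf S.
have at_ : a <= t by apply: lb_le_inf; [exists b | move=> y [/andP[]]].
have tb : t <= b by apply: ge_inf => //; case: iS.
have tab : a <= t <= b by rewrite at_ tb.
have before s : a <= s -> s < t -> f s < c.
  move=> as_ st; rewrite ltNge; apply/negP => cs.
  have : t <= s; last by rewrite leNgt st.
  by apply: ge_inf; [case: iS | split => //; rewrite as_ /= (le_trans (ltW st))].
exists t; split => //; apply/eqP; rewrite eq_le; apply/andP; split; rewrite leNgt; apply/negP => L.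
  have at' : a < t.
    by rewrite lt_neqAle at_ andbT; apply: contraTneq L => <-; rewrite -leNgt.
  have [|d d0 dP] := cf t (f t - c) tab; first by rewrite subr_gt0.
  pose y := Num.max a (t - d / 2).
  have yt : y < t by rewrite gt_max at' /= ltrBlDr ltrDl divr_gt0.
  have ay : a <= y by rewrite le_max lexx.
  have dy : t - d / 2 <= y by rewrite le_max lexx orbT.
  have := dP y; rewrite ay (le_trans (ltW yt) tb) => /(_ isT).
  rewrite gtr0_norm ?subr_gt0 // => /(_ ltac:(lra)).
  by have := before y ay yt; rewrite ltr_norml => ? /andP[]; lra.
have [|d d0 dP] := cf t (c - f t) tab; first by rewrite subr_gt0.
have [s [/andP[as_ sb] cs]] := inf_adherent d0 iS; rewrite -/t => std.
have ts : t <= s by apply: ge_inf; [case: iS | split => //; rewrite as_ sb].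
have := dP s; rewrite as_ sb => /(_ isT).
rewrite ler0_norm ?subr_le0 // => /(_ ltac:(lra)).
by rewrite ltr_norml => /andP[]; lra.
Qed.

Lemma last_hit f a b c : a <= b -> eps_continuous f a b -> f a <= c -> c <= f b ->
  exists t, [/\ a <= t <= b, f t = c & forall s, t < s -> s <= b -> c < f s].
Proof.
move=> ab cf fac cfb.
have [||||t [/andP[at_ tb] ft H]] := @first_hit (fun s => - f (a + b - s)) a b (- c).
- by [].
- move=> t e /andP[t1 t2] e0; have [|d d0 dP] := cf (a + b - t) e _ e0; first by lra.
  exists d => // y /andP[y1 y2] ty; rewrite -opprD normrN; apply: dP; first by lra.
  by rewrite (_ : a + b - t - (a + b - y) = - (t - y)) ?normrN //; lra.
- by rewrite lerN2 (_ : a + b - a = b) //; lra.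
- by rewrite lerN2 (_ : a + b - b = a) //; lra.
exists (a + b - t); split; [lra | lra | move=> s ts sb].
have := H (a + b - s) ltac:(lra) ltac:(lra).
by rewrite ltrN2 (_ : a + b - (a + b - s) = s) //; lra.
Qed.

(** Take the first time [v] at level [r'] and then the last time [u] before [v] at level [r]: in
    between, [f] is strictly between the levels. *)
Lemma upcrossing f a b r r' : r < r' -> a <= b -> eps_continuous f a b ->
  f a <= r -> r' <= f b ->
  exists u v, [/\ [/\ a <= u, u < v & v <= b], f u = r, f v = r' &
    forall t, u < t -> t < v -> r < f t < r'].
Proof.
move=> rr ab cf far rfb.
have [|v [/andP[av vb] fv Hv]] := @first_hit f a b r' ab cf _ rfb; first lra.
have [|||u [/andP[au uv] fu Hu]] := @last_hit f a v r av.
- exact: eps_continuousS cf.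
- by [].
- by rewrite fv ltW.
have uv' : u < v.
  by rewrite lt_neqAle uv andbT; apply: contraTneq rr => E; rewrite -fv -fu E ltxx.
exists u, v; split => // t ut tv; rewrite Hu ?ltW //= Hv //; lra.
Qed.

End hitting.

(** * Cutting a curve into pieces that cross annuli *)

Section crossings.
Context {R : realType} {X : metricType R}.
Implicit Types (g h : pcurve X) (x : X).

Lemma eps_continuous_mdist g x a b : lo g <= a -> b <= hi g ->
  eps_continuous (fun t => mdist x (g t)) a b.
Proof.
move=> la bh; apply: (eps_continuousS la bh) => t e tD e0.
have [|d d0 dP] := (within_continuous_mdistP _ _).1 (@pcurve_continuous _ _ g) t e _ e0.
  by rewrite /= in_itv.
exists d => // y yD ty; have := dP y _ ty; rewrite /= in_itv /= => /(_ yD).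
have := metric_triangle x (g t) (g y); have := metric_triangle x (g y) (g t).
by rewrite (metric_sym (g y)) ltr_norml; lra.
Qed.

Lemma crossing_exists g x r r' a b : r < r' -> lo g <= a -> a <= b -> b <= hi g ->
  (mdist x (g a) <= r /\ r' <= mdist x (g b)) \/
  (r' <= mdist x (g a) /\ mdist x (g b) <= r) ->
  exists uv, [/\ crossing_set g x r r' uv, a <= uv.1 & uv.2 <= b].
Proof.
move=> rr la ab bh; have cF := @eps_continuous_mdist g x a b la bh.
move=> [[Fa Fb]|[Fa Fb]].
  have [u [v [[au uv vb] Fu Fv H]]] := upcrossing rr ab cF Fa Fb.
  exists (u, v); split => //; split => //=.
  - by rewrite /dom /= in_itv /=; lra.
  - by rewrite /dom /= in_itv /=; lra.
  - by move=> t; rewrite in_itv /= => /andP[]; exact: H.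
  - by rewrite Fu Fv.
have [||||u [v [[au uv vb] Fu Fv H]]] :=
    @upcrossing R (fun t => - mdist x (g t)) a b (- r') (- r) _ ab.
- by rewrite ltrN2.
- move=> t e tD e0; have [d d0 dP] := cF t e tD e0; exists d => // y yD ty.
  by rewrite -opprD normrN; exact: dP.
- by rewrite lerN2.
- by rewrite lerN2.
exists (u, v); split => //; split => //=.
- by rewrite /dom /= in_itv /=; lra.
- by rewrite /dom /= in_itv /=; lra.
- by move=> t; rewrite in_itv /= => /andP[ut tv]; have := H t ut tv; lra.
- by rewrite setUC (oppr_inj Fu) (oppr_inj Fv).
Qed.

(** Cut greedily at the first time [t] when the curve is at distance [3 * e] from the start [g a] of
    the piece. A net point [p] within [e] of [g a] is within [4 * e] of the whole piece, while the
    distance to [p] grows from below [e] to at least [3 * e - e = 2 * e]: every cut comes with a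
    crossing around [p]. Either the end is reached within [n] pieces or [n] crossings have been
    collected. *)
Lemma labels_or_crossings g (F : set X) (e : R) : 0 < e ->
  (forall y, exists2 p, F p & mdist p y < e) -> forall n a, lo g <= a -> a < hi g ->
  (exists l, [/\ (size l <= n)%N, labelled g (4 * e) a l,
     forall p, p \in map snd l -> F p & last a (map fst l) = hi g]) \/
  (exists L : seq (X * (R * R)), [/\ size L = n, uniq L &
     forall z, z \in L -> [/\ F z.1, crossing_set g z.1 e (2 * e) z.2 & a <= z.2.1]]).
Proof.
move=> e0 net; elim=> [|n ih] a la ah; first by right; exists [::].
have [p Fp pa] := net (g a).
have single : (forall t, a <= t <= hi g -> mdist (g a) (g t) <= 3 * e) ->
    exists l, [/\ (size l <= n.+1)%N, labelled g (4 * e) a l,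
     forall p, p \in map snd l -> F p & last a (map fst l) = hi g].
  move=> H; exists [:: (hi g, p)]; split => //=; last by move=> q; rewrite inE => /eqP ->.
  split => // t tD; apply: le_trans (metric_triangle _ (g a) _) _.
  by have := H t tD; lra.
have [H|] := pselect (forall t, a <= t <= hi g -> mdist (g a) (g t) <= 3 * e).
  by left; exact: single.
move=> /existsNP[t1 /not_implyP[/andP[at1 t1h] /negP]]; rewrite -ltNge => h1.
have e3 : 0 <= 3 * e by rewrite mulr_ge0 // ltW.
have [||t [/andP[at_ tt1] ft Ht]] := @first_hit R (fun t => mdist (g a) (g t)) a t1 (3 * e) at1
    (@eps_continuous_mdist g (g a) a t1 la t1h).
- by rewrite mdistxx.
- exact: ltW.
have piece s : a <= s <= t -> mdist (g a) (g s) <= 3 * e.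
  move=> /andP[as_]; rewrite le_eqVlt => /orP[/eqP ->|st]; first by rewrite ft.
  exact/ltW/Ht.
have at' : a < t.
  rewrite lt_neqAle at_ andbT; apply/eqP => E; move: ft; rewrite -E mdistxx.
  by lra.
have th : t <= hi g := le_trans tt1 t1h.
have [||[u v] /= [cuv au vt]] := @crossing_exists g p e (2 * e) a t _ la at_ th.
- by lra.
- left; split; first exact: ltW.
  by have := metric_triangle (g a) p (g t); rewrite ft (metric_sym (g a)); lra.
have [th'|] := ltP t (hi g); last first.
  by move=> ht; left; apply: single => s /andP[as_ sh]; apply: piece; rewrite as_ (le_trans sh).
have [[l [sl ll Fl el]]|[L [sL uL LP]]] := ih t (le_trans la at_) th'.
  left; exists ((t, p) :: l); split => //=; last first.
    by move=> q; rewrite inE => /orP[/eqP ->//|]; exact: Fl.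
  split => // s sD; apply: le_trans (metric_triangle _ (g a) _) _.
  by have := piece s sD; lra.
right; exists ((p, (u, v)) :: L); split => /=; first by rewrite sL.
  (* The later crossings start at or after [t], whereas the new one starts before [t]. *)
  rewrite uL andbT; apply/negP => /LP[_ _ /= tu].
  by case: cuv => /= uv _ _ _ _; lra.
move=> z; rewrite inE => /orP[/eqP ->//|/LP[Fz cz tz]]; split => //.
exact: le_trans at_ tz.
Qed.

End crossings.

(** * Upper semicontinuity of crossing numbers of curves *)

Section crossing_bounds.
Context {R : realType} {X : metricType R}.
Implicit Types (g h : pcurve X) (x : X).

Lemma pcurve_labels g (F : seq X) (e : R) m : 0 < e ->
  (forall y, exists2 p, p \in F & mdist p y < e) ->
  (forall p, p \in F -> (pcurve_crossings g p e (2 * e) < m%:R%:E)%E) ->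
  exists2 L, curve_labels g (4 * e) L &
    (size L <= (size F * m).+1)%N /\ forall p, p \in L -> p \in F.
Proof.
move=> e0 net Fm.
have [[l [sl ll Fl el]]|[L [sL uL LP]]] :=
    @labels_or_crossings R X g [set` F] e e0 net (size F * m).+1 (lo g) (lexx _) (lo_lt_hi g).
  by exists (map snd l); [exists l | rewrite size_map].
suff : (size L <= size F * m)%N by rewrite sL ltnn.
apply: (@pigeonhole_count _ X F fst) => [z /LP[]//|p pF].
rewrite leqNgt; apply/negP => mp; have := Fm p pF; rewrite ltNge => /negP; apply.
apply: (@le_trans _ _ (count (fun z => z.1 == p) L)%:R%:E).
  by rewrite lee_fin ler_nat ltnW.
rewrite -size_filter -(size_map snd); apply: counting_ge.
  rewrite map_inj_in_uniq ?filter_uniq // => -[p1 z1] [p2 z2].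
  by rewrite !mem_filter /= => /andP[/eqP -> _] /andP[/eqP -> _] ->.
move=> z /mapP[[q w]]; rewrite mem_filter /= => /andP[/eqP -> /LP[_ cw _]] ->.
exact: cw.
Qed.

(** The case [n = 1] of [labels_or_crossings]: a curve consisting of one piece within [4 * e] of its
    label has diameter at most [8 * e]. *)
Lemma pcurve_diam_crossing g (F : seq X) (e : R) : 0 < e ->
  (forall y, exists2 p, p \in F & mdist p y < e) -> 8 * e < pcurve_diam g ->
  exists2 p, p \in F & (1 <= pcurve_crossings g p e (2 * e))%E.
Proof.
move=> e0 net eg.
have [[l [sl ll Fl el]]|[L [sL uL LP]]] :=
    @labels_or_crossings R X g [set` F] e e0 net 1%N (lo g) (lexx _) (lo_lt_hi g).
  suff : pcurve_diam g <= 8 * e by rewrite leNgt eg.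
  apply: pcurve_diam_le => t u; rewrite /dom /= !in_itv /= => tD uD.
  case: l sl ll {Fl} el => [|[b p] [|//]] _ /=.
    by move=> _ E; have := lo_lt_hi g; rewrite E ltxx.
  move=> [_ H _] E; rewrite E in H.
  apply: le_trans (metric_triangle _ p _) _; rewrite metric_sym.
  by have := H t tD; have := H u uD; lra.
case: L sL uL LP => [//|z [|//]] _ _ /(_ z (mem_head _ _))[Fz cz _].
exists z.1 => //; have := @counting_ge R _ (crossing_set g z.1 e (2 * e)) [:: z.2] isT.
by apply=> w; rewrite inE => /eqP ->.
Qed.

(** If two crossing intervals overlapped without being equal, an endpoint of one, where the level is
    [r] or [r'], would lie inside the other, where the level is strictly between. *)
Lemma crossing_disjoint g x r r' (c c' : R * R) : crossing_set g x r r' c ->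
  crossing_set g x r r' c' -> c <> c' -> c.2 <= c'.1 \/ c'.2 <= c.1.
Proof.
have lvl (a b : X) : [set mdist x a; mdist x b] = [set r; r'] ->
    (mdist x a = r \/ mdist x a = r') /\ (mdist x b = r \/ mdist x b = r').
  move=> E; split.
  - have : [set mdist x a; mdist x b] (mdist x a) by left.
    by rewrite E.
  - have : [set mdist x a; mdist x b] (mdist x b) by right.
    by rewrite E.
case: c c' => [u v] [u' v'] /= [/= uv _ _ H /lvl[Eu Ev]] [/= uv' _ _ H' /lvl[Eu' Ev']] ne.
have [|vu'] := ltP u' v; last by left.
have [|vu] := ltP u v'; last by right.
move=> uv1 uv2; exfalso; apply: ne.
have [L|L|E] := ltgtP u u'.
- by have := H u'; rewrite in_itv /= L uv2 => /(_ isT) /andP[l1 l2];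
  exfalso; case: Eu' => E0; rewrite E0 in l1 l2; lra.
- by have := H' u; rewrite in_itv /= L uv1 => /(_ isT) /andP[l1 l2];
  exfalso; case: Eu => E0; rewrite E0 in l1 l2; lra.
have [L|L|E'] := ltgtP v v'; last by rewrite E E'.
- by have := H' v; rewrite in_itv /= L -E uv => /(_ isT) /andP[l1 l2];
  exfalso; case: Ev => E0; rewrite E0 in l1 l2; lra.
- by have := H v'; rewrite in_itv /= L E uv' => /(_ isT) /andP[l1 l2];
  exfalso; case: Ev' => E0; rewrite E0 in l1 l2; lra.
Qed.

(** A set of two pairs is closed; [d1] and [d2] are the distances of [(a, b)] to the two pairs. *)
Lemma two_level_limit (a b r r' : R) :
  (forall e, 0 < e -> exists p q, [/\ (p = r /\ q = r') \/ (p = r' /\ q = r),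
    `|a - p| < e & `|b - q| < e]) ->
  (a = r /\ b = r') \/ (a = r' /\ b = r).
Proof.
move=> H; pose d1 := `|a - r| + `|b - r'|; pose d2 := `|a - r'| + `|b - r|.
have Z (s t u v : R) : `|s - t| + `|u - v| = 0 -> s = t /\ u = v.
  move=> /eqP; rewrite paddr_eq0 // !normr_eq0 !subr_eq0 => /andP[/eqP -> /eqP ->].
  by [].
have [/Z|d1n] := eqVneq d1 0; first by left.
have [/Z|d2n] := eqVneq d2 0; first by right.
have d10 : 0 < d1 by rewrite lt0r d1n addr_ge0.
have d20 : 0 < d2 by rewrite lt0r d2n addr_ge0.
have [|p [q [pq ap bq]]] := H (Num.min d1 d2 / 2).
  by rewrite divr_gt0 // lt_min d10.
have : Num.min d1 d2 <= d1 /\ Num.min d1 d2 <= d2 by rewrite !ge_min !lexx orbT.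
by case: pq ap bq => -[-> ->]; rewrite /d1 /d2; lra.
Qed.

Variables (g : pcurve X) (x : X) (r r' : R).
Hypothesis rr' : r < r'.

Let level (a b : R) := (mdist x (g a) = r /\ mdist x (g b) = r') \/
  (mdist x (g a) = r' /\ mdist x (g b) = r).

(** The homeomorphisms [s n] carry the crossings to the fixed domain of [g], where their endpoints
    subconverge. The limit interval need not be a crossing, since [g] may touch a level inside it;
    it only joins the two levels, and [crossing_exists] finds a crossing within it. *)
Lemma crossing_limit (h : nat -> pcurve X) (s : nat -> R -> R) (u v : nat -> R) :
  (forall n, increasing_homeo (h n) g (s n)) ->
  (forall e, 0 < e -> exists N, forall n, (N <= n)%N -> forall t, dom (h n) t ->
     mdist (h n t) (g (s n t)) < e) ->
  (forall n, crossing_set (h n) x r r' (u n, v n)) ->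
  exists2 phi, increasing_seq phi & exists a b,
    [/\ s (phi n) (u (phi n)) @[n --> \oo] --> a, s (phi n) (v (phi n)) @[n --> \oo] --> b,
        lo g <= a /\ b <= hi g, a <= b & level a b].
Proof.
move=> sh hg c.
have Ds n t : dom (h n) t -> lo g <= s n t <= hi g.
  by move=> Dt; have := increasing_homeo_dom (sh n) Dt; rewrite /dom /= in_itv.
have bnd (w : nat -> R) : (forall n, dom (h n) (w n)) -> forall phi : nat -> nat,
    bounded_fun (fun n => s (phi n) (w (phi n))).
  move=> Dw phi; exists (`|lo g| + `|hi g|); split; first exact: num_real.
  move=> M HM n _ /=; have /andP[l1 l2] := Ds _ _ (Dw (phi n)).
  have h1 := ler_norm (hi g); have := ler_norm (- lo g); rewrite normrN => h2.
  have h3 := normr_ge0 (hi g); have h4 := normr_ge0 (lo g).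
  by rewrite ler_norml; apply/andP; split; lra.
have Du n : dom (h n) (u n) by have [] := c n.
have Dv n : dom (h n) (v n) by have [] := c n.
have [phi phii /cvg_ex[a ua]] := bolzano_weierstrass (bnd u Du id).
have [th thi /cvg_ex[b vb]] := bolzano_weierstrass (bnd v Dv phi).
have {}ua : s (phi (th n)) (u (phi (th n))) @[n --> \oo] --> a.
  exact: (cvg_subsequence thi ua).
exists (phi \o th); first exact: increasing_seq_comp.
have ale : lo g <= a.
  apply: (ler_cvg_to (@cvg_cst _ (lo g) _ _ _) ua); apply: nearW => n.
  by have /andP[] := Ds _ _ (Du (phi (th n))).
have ble : b <= hi g.
  apply: (ler_cvg_to vb (@cvg_cst _ (hi g) _ _ _)); apply: nearW => n.
  by have /andP[] := Ds _ _ (Dv (phi (th n))).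
have ab : a <= b.
  apply: (ler_cvg_to ua vb); apply: nearW => n /=.
  have [_ m _ _] := sh (phi (th n)); have [/= uv _ _ _ _] := c (phi (th n)).
  by apply/ltW/m => //; apply: mem_set; [exact: Du | exact: Dv].
exists a, b; split => //; apply: two_level_limit => e e0.
have e2 : 0 < e / 2 by rewrite divr_gt0.
have [da da0 Ha] := eps_continuous_mdist (g := g) x (lexx _) (lexx _) (t := a)
  (ltac:(lra) : lo g <= a <= hi g) e2.
have [db db0 Hb] := eps_continuous_mdist (g := g) x (lexx _) (lexx _) (t := b)
  (ltac:(lra) : lo g <= b <= hi g) e2.
have [N HN] := hg _ e2.
have [n [nN na nb]] : exists n, [/\ (N <= n)%N, `|a - s n (u n)| < da & `|b - s n (v n)| < db].
  move/cvgrPdist_lt : ua => /(_ _ da0)[N1 _ H1].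
  move/cvgrPdist_lt : vb => /(_ _ db0)[N2 _ H2].
  exists (phi (th (N + N1 + N2)%N)); split.
  - apply: leq_trans (increasing_seq_le (increasing_seq_comp phii thi) _).
    by rewrite -addnA leq_addr.
  - by apply: H1; rewrite /= addnAC leq_addl.
  - by apply: H2; rewrite /= leq_addl.
have L : (mdist x (h n (u n)) = r /\ mdist x (h n (v n)) = r') \/
         (mdist x (h n (u n)) = r' /\ mdist x (h n (v n)) = r).
  have [_ _ _ _ /= E] := c n.
  have Eu : [set r; r'] (mdist x (h n (u n))) by rewrite -E; left.
  have Ev : [set r; r'] (mdist x (h n (v n))) by rewrite -E; right.
  have Er : [set mdist x (h n (u n)); mdist x (h n (v n))] r by rewrite E; left.
  have Er' : [set mdist x (h n (u n)); mdist x (h n (v n))] r' by rewrite E; right.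
  move: Eu Ev Er Er' => /= [] Eu [] Ev Er Er'; rewrite Eu Ev.
  - by move: Er'; rewrite Eu Ev => -[] E'; move: rr'; rewrite E' ltxx.
  - by left.
  - by right.
  - by move: Er; rewrite Eu Ev => -[] E'; move: rr'; rewrite E' ltxx.
have near_level w t : dom (h n) w -> `|mdist x (g t) - mdist x (g (s n w))| < e / 2 ->
    `|mdist x (g t) - mdist x (h n w)| < e.
  move=> Dw; have := HN n nN w Dw.
  have := metric_triangle x (h n w) (g (s n w)); have := metric_triangle x (g (s n w)) (h n w).
  by rewrite (metric_sym (g (s n w))) !ltr_norml; lra.
exists (mdist x (h n (u n))), (mdist x (h n (v n))); split => //.
- by apply: near_level => //; apply: Ha => //; exact: Ds.
- by apply: near_level => //; apply: Hb => //; exact: Ds.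
Qed.

Let level_lt a b : a <= b -> level a b -> a < b.
Proof.
move=> ab lv; rewrite lt_neqAle ab andbT; apply/eqP => E.
by move: lv rr'; rewrite /level E => -[[-> ->]|[-> ->]]; rewrite ltxx.
Qed.

(** Infinitely many crossings would have a subsequence whose endpoints converge to some [a < b], so
    two distinct crossings would overlap. *)
Lemma finite_crossings : finite_set (crossing_set g x r r').
Proof.
apply: contrapT => inf; have /pcard_leP/unsquash f := (infiniteP _).1 inf.
have fc n : crossing_set g x r r' (f n) by exact: funS.
have [|||phi phii [a [b [ua vb _ ab lv]]]] :=
  @crossing_limit (fun=> g) (fun=> id) (fun n => (f n).1) (fun n => (f n).2).
- by move=> _; exact: increasing_homeo_id.
- by move=> e e0; exists 0%N => n _ t _; rewrite mdistxx.
- by move=> n; rewrite -surjective_pairing.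
have ab' := level_lt ab lv.
have e0 : 0 < (b - a) / 2 by lra.
move/cvgrPdist_lt : ua => /(_ _ e0)[N1 _ H1].
move/cvgrPdist_lt : vb => /(_ _ e0)[N2 _ H2].
pose n := (N1 + N2)%N.
have ne : f (phi n) <> f (phi n.+1).
  move=> E; have Ep : phi n = phi n.+1 by apply: (@inj _ _ _ f); rewrite ?in_setT.
  have /increasing_seqP/(_ n) := phii; by rewrite Ep ltxx.
have := H1 n (leq_addr _ _); have := H1 n.+1 (leq_trans (leq_addr _ _) (leqnSn _)).
have := H2 n (leq_addl _ _); have := H2 n.+1 (leq_trans (leq_addl _ _) (leqnSn _)).
rewrite !ltr_norml /=.
by case: (crossing_disjoint (fc (phi n)) (fc (phi n.+1)) ne) => /=; lra.
Qed.

(** Otherwise some curves converging to [g] have [K.+1] crossings each, where [K] is the number for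
    [g]. In the limit these give [K.+1] non-overlapping intervals, each containing a crossing of
    [g]. *)
Lemma crossings_usc : exists2 e, 0 < e & forall h, pcurve_dist h g < e ->
  (pcurve_crossings h x r r' <= pcurve_crossings g x r r')%E.
Proof.
apply: contrapT => /forall2NP H.
pose K := #|` fset_set (crossing_set g x r r')|%fset.
have KE : pcurve_crossings g x r r' = K%:R%:E.
  by rewrite /pcurve_crossings /counting asboolT //; exact: finite_crossings.
have /choice[hw hwP] : forall n, exists hw : pcurve X * (seq (R * R)),
    [/\ pcurve_dist hw.1 g < 2^-1 ^+ n, uniq hw.2, size hw.2 = K.+1 &
      forall z, z \in hw.2 -> crossing_set hw.1 x r r' z].
  move=> n; have [|] := H (2^-1 ^+ n); first by rewrite exprn_gt0 //; lra.
  move=> /existsNP[h /not_implyP[hg /negP]]; rewrite -ltNge KE => Kh.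
  have [|w [uw sw wP]] := @counting_geP R _ (crossing_set h x r r') K.+1.
    move: Kh; rewrite /pcurve_crossings /counting; case: asboolP => _; last by rewrite leey.
    by rewrite lte_fin lee_fin ltr_nat ler_nat.
  by exists (h, w).
have /choice[s sP] : forall n, exists s, increasing_homeo (hw n).1 g s /\
    forall t, dom (hw n).1 t -> mdist ((hw n).1 t) (g (s t)) < 2^-1 ^+ n.
  by move=> n; have [/pcurve_dist_lt[s] hs ? _ _ _] := hwP n; exists s.
pose u i n := (nth (0, 0) (hw n).2 i).1; pose v i n := (nth (0, 0) (hw n).2 i).2.
pose P i (phi : nat -> nat) := (i < K.+1)%N -> exists a b,
    [/\ s (phi n) (u i (phi n)) @[n --> \oo] --> a, s (phi n) (v i (phi n)) @[n --> \oo] --> b,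
        lo g <= a /\ b <= hi g, a <= b & level a b].
have P1 i phi : increasing_seq phi -> exists2 th, increasing_seq th & P i (phi \o th).
  move=> phii; have [iK|Ki] := ltnP i K.+1; last by exists id => //; rewrite /P ltnNge Ki.
  have [|||th thi thP] := @crossing_limit (fun n => (hw (phi n)).1) (fun n => s (phi n))
     (fun n => u i (phi n)) (fun n => v i (phi n)).
  - by move=> n; have [] := sP (phi n).
  - move=> e /half_expr_lt[N Ne]; exists N => n Nn t Dt.
    have [_ /(_ _ Dt)/lt_le_trans] := sP (phi n); apply.
    apply: le_trans (ltW Ne); apply: half_expr_le.
    exact: leq_trans Nn (increasing_seq_le phii n).
  - move=> n; have [_ _ sw] := hwP (phi n); apply.
    by rewrite -surjective_pairing mem_nth // sw.
  - by exists th.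
have P2 i phi psi m : P i phi ->
    (exists2 th, increasing_seq th & forall n, psi (n + m)%N = phi (th n)) -> P i psi.
  move=> Pi [th thi E] /Pi[a [b [ua vb [la bh] ab lv]]].
  exists a, b; split => //; rewrite -(cvg_shiftn m); under eq_fun do rewrite E.
    exact: (cvg_subsequence thi ua).
  exact: (cvg_subsequence thi vb).
have [phi phii phiP] := diagonal_subsequence P1 P2.
have /choice[w wP] : forall i, exists w : R * R * (R * R), (i < K.+1)%N ->
    [/\ s (phi n) (u i (phi n)) @[n --> \oo] --> w.1.1,
        s (phi n) (v i (phi n)) @[n --> \oo] --> w.1.2,
        crossing_set g x r r' w.2, w.1.1 <= w.2.1 & w.2.2 <= w.1.2].
  move=> i; have [iK|Ki] := ltnP i K.+1; last by exists ((0, 0), (0, 0)).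
  have [a [b [ua vb [la bh] ab lv]]] := phiP i iK.
  have [|c [cc ac cb]] := @crossing_exists R X g x r r' a b rr' la ab bh.
    by case: lv => -[-> ->]; [left|right].
  by exists ((a, b), c).
have wlt i : (i < K.+1)%N -> (w i).2.1 < (w i).2.2.
  by move=> iK; have [_ _ [/= uv _ _ _ _] _ _] := wP i iK.
(* The homeomorphisms keep the order of disjoint crossings, so overlapping limits are contradicted
   once the relevant endpoints are within half of the overlap of their limits. *)
have sep i j : (i < K.+1)%N -> (j < K.+1)%N -> i <> j ->
    (w i).1.2 <= (w j).1.1 \/ (w j).1.2 <= (w i).1.1.
  move=> iK jK ij; apply: contrapT => /not_orP[/negP + /negP].
  rewrite -!ltNge => l1 l2.
  have [ui vi _ _ _] := wP i iK; have [uj vj _ _ _] := wP j jK.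
  have e10 : 0 < ((w i).1.2 - (w j).1.1) / 2 by lra.
  have e20 : 0 < ((w j).1.2 - (w i).1.1) / 2 by lra.
  move/cvgrPdist_lt : ui => /(_ _ e20)[N1 _ H1].
  move/cvgrPdist_lt : vi => /(_ _ e10)[N2 _ H2].
  move/cvgrPdist_lt : uj => /(_ _ e10)[N3 _ H3].
  move/cvgrPdist_lt : vj => /(_ _ e20)[N4 _ H4].
  pose n := (N1 + N2 + N3 + N4)%N.
  have h1 := H1 n (ltac:(rewrite /= /n; lia)); have h2 := H2 n (ltac:(rewrite /= /n; lia)).
  have h3 := H3 n (ltac:(rewrite /= /n; lia)); have h4 := H4 n (ltac:(rewrite /= /n; lia)).
  have [_ uw sw cw] := hwP (phi n).
  have [hs _] := sP (phi n); have [_ m _ _] := hs.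
  have ci : crossing_set (hw (phi n)).1 x r r' (nth (0, 0) (hw (phi n)).2 i).
    by apply: cw; rewrite mem_nth // sw.
  have cj : crossing_set (hw (phi n)).1 x r r' (nth (0, 0) (hw (phi n)).2 j).
    by apply: cw; rewrite mem_nth // sw.
  have ne : nth (0, 0) (hw (phi n)).2 i <> nth (0, 0) (hw (phi n)).2 j.
    by move/eqP; rewrite nth_uniq ?sw // => /eqP.
  have mono y z : dom (hw (phi n)).1 y -> dom (hw (phi n)).1 z -> y <= z ->
      s (phi n) y <= s (phi n) z.
    move=> Dy Dz; rewrite le_eqVlt => /orP[/eqP ->//|yz].
    by apply/ltW/m => //; exact: mem_set.
  have [_ Dui Dvi _ _] := ci; have [_ Duj Dvj _ _] := cj.
  move: h1 h2 h3 h4; rewrite !ltr_norml.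
  case: (crossing_disjoint ci cj ne) => [/mono|/mono] /(_ ltac:(done) ltac:(done));
    rewrite -/(u i (phi n)) -/(v i (phi n)) -/(u j (phi n)) -/(v j (phi n)); lra.
have := @counting_ge R _ (crossing_set g x r r') (mkseq (fun i => (w i).2) K.+1).
rewrite -/(pcurve_crossings g x r r') KE size_mkseq => CG.
suff : (K.+1%:R%:E <= K%:R%:E :> \bar R)%E by rewrite lee_fin ler_nat ltnn.
apply: CG.
  apply/mkseq_uniqP => i j; rewrite !inE => iK jK E; apply: contrapT => ij.
  have [_ _ _ ai bi] := wP i iK; have [_ _ _ aj bj] := wP j jK.
  have := wlt i iK; have := wlt j jK; rewrite E in ai bi *.
  by case: (sep i j iK jK ij); lra.
by move=> z /mapP[i]; rewrite mem_iota /= add0n => iK ->; have [] := wP i iK.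
Qed.

End crossing_bounds.

(** * Compactness of collections *)

Section esum_extra.
Context {R : realType}.
Local Open Scope ereal_scope.

Lemma esum_subset (T : choiceType) (I J : set T) (a : T -> \bar R) :
  I `<=` J -> \esum_(i in I) a i <= \esum_(i in J) a i.
Proof.
move=> IJ; apply: ge_ereal_sup => _ [A [fA AI] <-]; apply: ereal_sup_ubound.
by exists A => //; split => //; exact: subset_trans IJ.
Qed.

(** A relation instead of a map, since a matching is a set of pairs; indices with a zero term need
    no partner. *)
Lemma le_esum_inj_rel (T T' : choiceType) (I : set T) (J : set T')
    (a : T -> \bar R) (b : T' -> \bar R) (Q : T -> T' -> Prop) :
  (forall i, I i -> a i != 0 -> exists j, [/\ J j, Q i j & a i <= b j]) ->
  (forall i i' j, Q i j -> Q i' j -> i = i') ->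
  \esum_(i in I) a i <= \esum_(j in J) b j.
Proof.
move=> H Qinj; pose I0 := [set i | a i != 0].
have -> : \esum_(i in I) a i = \esum_(i in I `&` I0) a i.
  rewrite esum_mkcondr; apply: eq_esum => i Ii.
  case: (boolP (i \in I0)) => // /negP ni; apply/eqP/negPn/negP => ai.
  by apply: ni; exact: mem_set.
(* [option] supplies a default value, as [T'] may be empty. *)
have /choice[k kP] : forall i, exists j : option T',
    (I `&` I0) i -> exists j', [/\ j = Some j', J j', Q i j' & a i <= b j'].
  move=> i; have [[Ii ai]|ni] := pselect ((I `&` I0) i); last by exists None.
  by have [j [Jj Qj ab]] := H i Ii ai; exists (Some j); exists j.
pose b' (j : option T') := if j is Some j' then b j' else 0.
apply: (@le_trans _ _ (\esum_(i in I `&` I0) b' (k i))).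
  by apply: le_esum => i /kP[j [-> _ _]].
rewrite -(esum_image (I `&` I0) k b'); last first.
  move=> i i'; rewrite !inE => /kP[j [-> _ Qij _]] /kP[j' [-> _ Qij' _]] [E].
  by rewrite -E in Qij'; exact: Qinj Qij Qij'.
apply: (@le_trans _ _ (\esum_(j in Some @` J) b' j)).
  by apply: esum_subset => _ [i /kP[j [-> Jj _ _]] <-]; exists j.
by rewrite esum_image // => j j' _ _ [].
Qed.

Lemma esum_ge_size (T : choiceType) (I : set T) (a : T -> \bar R) (s : seq T) :
  uniq s -> (forall i, i \in s -> I i) -> (forall i, i \in s -> 1 <= a i) ->
  (size s)%:R%:E <= \esum_(i in I) a i.
Proof.
move=> us sI sa; apply: esum_ge; exists [set` s]; first by split => // i /sI.
rewrite -fsbig_seq //; elim: s {us sI} sa => [|i s ih] sa; first by rewrite big_nil.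
rewrite big_cons /= -nat1r EFinD leeD ?sa ?mem_head // ih // => j js.
by apply: sa; rewrite inE js orbT.
Qed.

End esum_extra.

(** * Upper semicontinuity of crossing numbers of collections *)

Section coll_crossings.
Context {R : realType} {X : metricType R}.
Implicit Types (G H : collection X) (p : curve X).

Lemma crossings_ge0 p x r r' : (0 <= crossings p x r r')%E.
Proof.
by rewrite /crossings /pcurve_crossings /counting; case: ifPn => _; rewrite ?lee_fin ?leey.
Qed.

Lemma crossing_diam p x r r' : crossings p x r r' != 0%E -> r' - r <= diam p.
Proof.
move=> c0; have [uv [_ Du Dv _ E]] : crossing_set (repr p) x r r' !=set0.
  apply/set0P; apply: contra c0 => /eqP E; rewrite /crossings /pcurve_crossings E.
  by rewrite /counting asboolT // fset_set0.
have := pcurve_diam_ub Du Dv; rewrite -/(diam p); apply: le_trans.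
have Er : [set r; r'] (mdist x (repr p uv.1)) by rewrite -E; left.
have Er1 : [set mdist x (repr p uv.1); mdist x (repr p uv.2)] r by rewrite E; left.
have Er2 : [set mdist x (repr p uv.1); mdist x (repr p uv.2)] r' by rewrite E; right.
have h0 := mdist_ge0 (repr p uv.1) (repr p uv.2).
have := metric_triangle x (repr p uv.1) (repr p uv.2).
have := metric_triangle x (repr p uv.2) (repr p uv.1).
rewrite (metric_sym (repr p uv.2)).
by case: Er1 => /= ->; case: Er2 => /= ->; lra.
Qed.

Lemma coll_crossings_fin G x r r' : r < r' -> (coll_crossings G x r r' < +oo)%E.
Proof.
(* A curve with a crossing has diameter at least [r' - r]; halving turns this into a strict
   inequality. *)
move=> rr; pose D := [set e | occ G e /\ (r' - r) / 2 < diam e.1].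
have fD : finite_set D by apply: mult_finite; lra.
apply: (@le_lt_trans _ _ (\esum_(e in D) crossings e.1 x r r')%E).
  apply: (@le_esum_inj_rel R _ _ _ _ _ _ eq) => [e Ge ce|e e' j -> -> //].
  by exists e; split => //; split => //; have := crossing_diam ce; lra.
rewrite esum_fset //.
rewrite fsbig_finite // lte_sum_pinfty // => e _.
by rewrite /crossings /pcurve_crossings /counting asboolT ?ltry //; exact: finite_crossings.
Qed.

Lemma finite_common_radius (T : choiceType) (A : set T) (P : T -> R -> Prop) :
  finite_set A -> (forall a, A a -> exists2 e, 0 < e & forall d, d <= e -> P a d) ->
  exists2 e, 0 < e & forall a d, A a -> d <= e -> P a d.
Proof.
move=> fA H; suff [e e0 eP] : exists2 e, 0 < e &
    forall a d, a \in enum_fset (fset_set A) -> d <= e -> P a d.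
  exists e => // a d Aa; apply: eP.
  have : a \in fset_set A by rewrite in_fset_set //; exact: mem_set.
  by [].
have {}H a : a \in enum_fset (fset_set A) -> exists2 e, 0 < e & forall d, d <= e -> P a d.
  move=> aA; apply: H; have : a \in fset_set A by [].
  by rewrite in_fset_set // => /set_mem.
elim: (enum_fset _) H => [|a s ih] H; first by exists 1.
have [|e e0 eP] := ih; first by move=> b bs; apply: H; rewrite inE bs orbT.
have [e' e0' eP'] := H a (mem_head _ _).
exists (Num.min e e'); first by rewrite lt_min e0.
move=> b d; rewrite inE le_min => /orP[/eqP ->|bs] /andP[de de']; first exact: eP'.
exact: eP.
Qed.

(** If [H] is near [G], a curve of [H] with a crossing is too large to be unmatched, and its partner
    in [G] has diameter at least [(r' - r) / 2]. Only finitely many curves of [G] are that large, so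
    one radius of upper semicontinuity serves them all, and the sums are compared along the
    matching. *)
Lemma open_crossings_lt (x : X) (r r' : R) (n : nat) : r < r' ->
  open [set G : collection X | (coll_crossings G x r r' < n%:R%:E)%E].
Proof.
move=> rr; rewrite openE => G /= Gn; apply/nbhs_collP.
pose D := [set e | occ G e /\ (r' - r) / 4 < diam e.1].
have fD : finite_set D by apply: mult_finite; lra.
have [a _|e e0 eP] := @finite_common_radius (curve X * nat)%type D (fun a d => forall q : curve X,
    mdist a.1 q < d -> (crossings q x r r' <= crossings a.1 x r r')%E) fD.
  have [e e0 eP] := @crossings_usc R X (repr a.1) x r r' rr.
  exists e => // d de q aq; apply: eP; rewrite pcurve_dist_sym.
  exact: lt_le_trans de.
exists (Num.min e (r' - r) / 4); first by rewrite divr_gt0 // lt_min e0 subr_gt0.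
move=> H /coll_dist_lt[pi [piS pi1 pi2]].
have m1 : Num.min e (r' - r) <= e by rewrite ge_min lexx.
have m2 : Num.min e (r' - r) <= r' - r by rewrite ge_min lexx orbT.
have m0 : 0 < Num.min e (r' - r) by rewrite lt_min e0 subr_gt0.
move=> /(matching_cost_leP _ _ _ (ltac:(lra) : 0 <= Num.min e (r' - r) / 4))[c1 c2 c3].
apply: le_lt_trans Gn.
apply: (@le_esum_inj_rel R _ _ _ _ _ _ (fun b a => pi (a, b))) => [b Hb cb|b b' a pb pb'].
  have db := crossing_diam cb.
  have [[a pab]|na] := pselect (exists a, pi (a, b)); last first.
    suff : diam b.1 <= Num.min e (r' - r) / 4 by lra.
    by apply: c3; split => // a pab; apply: na; exists a.
  have [/= Ga _] := piS _ pab; have ab := c1 _ _ pab.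
  exists a; split => //; apply: (eP a e) => //; last by lra.
  by split => //; have := diam_lip b.1 a.1; rewrite metric_sym; lra.
by have [->] := pi1 _ _ (mem_set pb) (mem_set pb') erefl.
Qed.

End coll_crossings.

(** Gaps ([None]) let one system of indices serve all collections, finite or infinite. *)
Definition enumeration (R : realType) (X : metricType R) (G : collection X)
    (en : nat -> option (curve X * nat)) :=
  [/\ forall i e, en i = Some e -> occ G e,
      forall i j e, en i = Some e -> en j = Some e -> i = j &
      forall e, occ G e -> exists i, en i = Some e].

Section collection_of_family.
Context {R : realType} {X : metricType R}.
Variable f : nat -> option (curve X).
Hypothesis f_diam : forall i p, f i = Some p -> 0 < diam p.
Hypothesis f_fin : forall d : R, 0 < d -> exists C, forall i p,
  f i = Some p -> d < diam p -> (i < C)%N.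

Let rank (p : curve X) i := count (fun j => f j == Some p) (iota 0 i).

Let rankS p i : rank p i.+1 = (rank p i + (f i == Some p))%N.
Proof. by rewrite /rank -addn1 iotaD count_cat /= addn0. Qed.

Let rank_lt p i j : f i = Some p -> (i < j)%N -> (rank p i < rank p j)%N.
Proof.
move=> fi; elim: j => // j ih; rewrite ltnS leq_eqVlt rankS => /orP[/eqP <-|/ih].
  by rewrite fi eqxx addn1.
by move=> /leq_trans; apply; exact: leq_addr.
Qed.

Let rank_onto p C r : (r < rank p C)%N -> exists i, f i = Some p /\ rank p i = r.
Proof.
elim: C => // C ih; rewrite rankS.
case: (f C =P Some p) => [fC|_]; last by rewrite addn0; exact: ih.
rewrite addn1 ltnS leq_eqVlt => /orP[/eqP ->|/ih //].
by exists C.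
Qed.

(* The i-th member of the family becomes the k-th copy of its curve, where k
   counts the earlier members equal to it. *)
Lemma collection_of_family : exists (G : collection X) (rho : nat -> option (curve X * nat)),
  enumeration G rho /\ forall i, omap fst (rho i) = f i.
Proof.
have /choice[C CP] : forall p, exists C, forall i, f i = Some p -> (i < C)%N.
  move=> p; have [p0|p0] := ltP 0 (diam p); last first.
    by exists 0%N => i /f_diam; rewrite ltNge p0.
  have [|C CP] := @f_fin (diam p / 2); first by rewrite divr_gt0.
  by exists C => i /CP; apply; lra.
pose rho i := omap (fun p => (p, rank p i)) (f i).
pose m p := rank p (C p).
have onto e : (e.2 < m e.1)%N -> exists i, rho i = Some e.
  by move=> /rank_onto[i [fi ri]]; exists i; rewrite /rho fi /= ri -surjective_pairing.
have rhoE i e : rho i = Some e -> f i = Some e.1 /\ rank e.1 i = e.2.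
  by rewrite /rho; case fi : (f i) => [p|//] [<-].
have fin (d : R) : 0 < d -> finite_set [set e | occ m e /\ d < diam e.1].
  move=> d0; have [D DP] := f_fin d0.
  apply: (@sub_finite_set _ _ (Some @^-1` (rho @` `I_D))).
    move=> e /= [/onto[i ie] de]; exists i => //; have [fi _] := rhoE _ _ ie.
    exact: DP fi de.
  apply: finite_preimage; last exact/finite_image/finite_II.
  by move=> ? ? _ _ [].
have pos e : occ m e -> exists2 d, 0 < d & d < diam e.1.
  move=> /onto[i /rhoE[/f_diam e0 _]].
  by exists (diam e.1 / 2); [rewrite divr_gt0 | lra].
exists (Collection fin pos), rho; split; last by move=> i; rewrite /rho; case: (f i).
split.
- by move=> i e /rhoE[fi re]; rewrite /occ /= -re; apply: rank_lt => //; exact: CP.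
- move=> i j e /rhoE[fi ri] /rhoE[fj rj].
  have [ij|ji|//] := ltngtP i j.
  + by have := rank_lt fi ij; rewrite ri rj ltnn.
  + by have := rank_lt fj ji; rewrite ri rj ltnn.
- by move=> e /onto.
Qed.

End collection_of_family.

Section coll_dist_enum.
Context {R : realType} {X : metricType R}.
Implicit Types G H : collection X.

(** Match equal indices when the curves are within [e]; whatever remains unmatched has diameter at
    most [e]. *)
Lemma coll_dist_enum G H en en' (e : R) : 0 <= e ->
  enumeration G en -> enumeration H en' ->
  (forall i, match en i, en' i with
    | Some a, Some b => mdist a.1 b.1 <= e \/ (diam a.1 <= e /\ diam b.1 <= e)
    | Some a, None => diam a.1 <= e
    | None, Some b => diam b.1 <= e
    | None, None => True
    end) -> (coll_dist G H <= e%:E)%E.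
Proof.
move=> e0 [G1 G2 G3] [H1 H2 H3] close.
apply: (@coll_dist_le _ _ _ _ [set ab | exists i, [/\ en i = Some ab.1, en' i = Some ab.2 &
    mdist ab.1.1 ab.2.1 <= e]]).
  split.
  - by move=> [a b] /= [i [/G1 Ga /H1 Hb _]].
  - move=> [a b] [a' b']; rewrite !inE /= => -[i [ia ib _]] [j [ja jb _]] E.
    rewrite -E in ja; have ij := G2 _ _ _ ia ja.
    by move: jb; rewrite -ij ib E => -[->].
  - move=> [a b] [a' b']; rewrite !inE /= => -[i [ia ib _]] [j [ja jb _]] E.
    rewrite -E in jb; have ij := H2 _ _ _ ib jb.
    by move: ja; rewrite -ij ia E => -[->].
apply/matching_cost_leP => //; split=> [a b [i []]//|a [Ga un]|b [Hb un]].
- have [i ia] := G3 _ Ga; have := close i; rewrite ia.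
  case ib : (en' i) => [b|//] [ab|[]//].
  by exfalso; apply: (un b); exists i.
- have [i ib] := H3 _ Hb; have := close i; rewrite ib.
  case ia : (en i) => [a|//] [ab|[]//].
  by exfalso; apply: (un a); exists i.
Qed.

End coll_dist_enum.

Section compactness.
Context {R : realType} {X : metricType R}.
Implicit Types G H : collection X.

(** The level of a curve is the first [k] with [d k] below its diameter, and the [j]-th curve of
    level [k] gets the index coding [(k, j)]. A curve of diameter above [d k] has level at most [k],
    and level [l] has at most [c l] members, so its index is bounded independently of [G]. *)
Lemma uniform_enumeration (d : nat -> R) (c : nat -> nat) :
  (forall e, 0 < e -> exists k, d k < e) ->
  exists C : nat -> nat, forall G,
    (forall k s, uniq s -> (forall e, e \in s -> occ G e /\ d k < diam e.1) ->
      (size s <= c k)%N) ->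
    exists2 en, enumeration G en &
      forall i e k, en i = Some e -> d k < diam e.1 -> (i < C k)%N.
Proof.
move=> d0; exists (fun k => (\max_(l < k.+1) \max_(j < c l) choice.pickle (l : nat, j : nat)).+1).
move=> G bG.
pose L k := [set e | occ G e /\ d k < diam e.1 /\ forall l, (l < k)%N -> diam e.1 <= d l].
have fL k : finite_set (L k).
  apply: contrapT => /(@infinite_set_fset _ _ (c k).+1)[B BL cB].
  suff : (#|` B| <= c k)%N by rewrite leqNgt cB.
  by apply: bG; [exact: fset_uniq | move=> e eB; have [? []] := BL e eB].
pose s k := enum_fset (fset_set (L k)).
have sL k e : e \in s k <-> L k e.
  have -> : (e \in s k) = (e \in fset_set (L k)) by [].
  by rewrite in_fset_set //; split=> [/set_mem|/mem_set].
have us k : uniq (s k) by exact: fset_uniq.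
have ss k : (size (s k) <= c k)%N.
  by apply: bG => // e /sL[? []].
have levels k k' e : L k e -> L k' e -> k = k'.
  move=> [_ [h1 h2]] [_ [h1' h2']]; have [kk|kk|//] := ltngtP k k'.
    by have := h2' _ kk; rewrite leNgt h1.
  by have := h2 _ kk; rewrite leNgt h1'.
pose en i := if choice.pickle_inv i is Some kj then
  nth None (map Some (s kj.1)) kj.2 else None.
have enP i e : en i = Some e -> exists k j,
    [/\ i = choice.pickle (k, j), (j < size (s k))%N, L k e & index e (s k) = j].
  rewrite /en; case E : (choice.pickle_inv i) => [[k j]|//] /=.
  have := @choice.pickle_invK (nat * nat)%type i; rewrite E /= => <-.
  have [jk|] := ltnP j (size (s k)); last first.
    by move=> kj; rewrite nth_default // size_map.
  rewrite (nth_map e) // => -[es]; exists k, j; split => //.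
    by apply/sL; rewrite -es mem_nth.
  by rewrite -es index_uniq.
exists en; first split.
- by move=> i e /enP[k [j [_ _ []]]].
- move=> i i' e /enP[k [j [-> _ Lk jE]]] /enP[k' [j' [-> _ Lk' jE']]].
  by rewrite -jE -jE' (levels _ _ _ Lk Lk').
- move=> e Ge; have [dl dl0 dle] := mult_diam Ge.
  have [k dk] : exists k, d k < diam e.1 by apply: d0; exact: lt_trans dle.
  have [l dle' lmin] := ex_minnP (ex_intro (fun k => d k < diam e.1) k dk).
  have Le : L l e.
    by do 2!split => //; move=> l' l'l; rewrite leNgt; apply/negP => /lmin; rewrite leqNgt l'l.
  exists (choice.pickle (l, index e (s l))); rewrite /en choice.pickleK_inv /=.
  have es : e \in s l by apply/sL.
  by rewrite (nth_map e) ?index_mem // nth_index.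
move=> i e k /enP[l [j [-> jl [_ [_ Ll]] _]]] dk; rewrite ltnS.
have lk : (l < k.+1)%N by rewrite ltnS leqNgt; apply/negP => /Ll; rewrite leNgt dk.
have jc : (j < c l)%N := leq_trans jl (ss l).
apply: leq_trans (leq_bigmax (Ordinal lk)).
exact: (leq_bigmax (Ordinal jc)).
Qed.

Hypothesis cX : compact [set: X].
Variables (eps : nat -> R) (F : nat -> seq X) (m : nat -> nat).
Hypothesis eps_gt0 : forall k, 0 < eps k.
Hypothesis eps_cvg : forall e, 0 < e -> exists k, eps k < e.
Hypothesis net : forall k y, exists2 p, p \in F k & mdist p y < eps k.

Definition bounded_crossings : set (collection X) :=
  [set G | forall k p, p \in F k ->
    (coll_crossings G p (eps k) (2 * eps k) < (m k)%:R%:E)%E].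

Lemma crossings_le_coll G e x r r' : occ G e ->
  (crossings e.1 x r r' <= coll_crossings G x r r')%E.
Proof.
move=> Ge; rewrite -[leLHS](@esum_set1 R _ e (fun e => crossings e.1 x r r')) ?crossings_ge0 //.
by apply: esum_subset => _ ->.
Qed.

(** Each such curve crosses an annulus around some net point; those choosing the same point are at
    most [m k], as each adds at least 1 to its crossing count. *)
Lemma bounded_crossings_size G k s : bounded_crossings G -> uniq s ->
  (forall e, e \in s -> occ G e /\ 8 * eps k < diam e.1) -> (size s <= size (F k) * m k)%N.
Proof.
move=> BG us sG.
have /choice[f fP] : forall e, exists p : option X, e \in s -> exists2 q, p = Some q &
    q \in F k /\ (1 <= crossings e.1 q (eps k) (2 * eps k))%E.
  move=> e; have [es|] := boolP (e \in s); last by exists None.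
  have [p pF cp] := pcurve_diam_crossing (eps_gt0 k) (net k) (sG e es).2.
  by exists (Some p) => _; exists p.
rewrite -(size_map Some (F k)); apply: (@pigeonhole_count _ _ (map Some (F k)) f).
  by move=> e /fP[q -> [qF _]]; exact: map_f.
move=> _ /mapP[p pF ->]; rewrite -size_filter -(ler_nat R) -lee_fin.
apply: le_trans (ltW (BG k p pF)); apply: esum_ge_size; first exact: filter_uniq.
  by move=> e; rewrite mem_filter => /andP[_ /sG[]].
move=> e; rewrite mem_filter => /andP[/eqP fe es].
by have [q] := fP e es; rewrite fe => -[->] [].
Qed.

Lemma curve_labels_le (g : pcurve X) (d d' : R) L :
  d <= d' -> curve_labels g d L -> curve_labels g d' L.
Proof.
move=> dd [l ll lP]; exists l => //; move: (lo g) ll {lP}.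
elim: l => //= tp l ih a [at_ H /ih]; split => // x xD.
exact: le_trans (H x xD) dd.
Qed.

Lemma bounded_crossings_curves (G : nat -> collection X) (e : nat -> curve X * nat) :
  (forall n, bounded_crossings (G n)) -> (forall n, occ (G n) (e n)) ->
  exists2 phi, increasing_seq phi & exists p : curve X, (e (phi n)).1 @[n --> \oo] --> p.
Proof.
move=> BG Ge; have [|phi phii [h hP]] := @pcurve_subsequence R X cX (fun n => repr (e n).1).
  (* [pcurve_labels] works at scale [4 * eps k], hence the quarter. *)
  move=> d d0; have [|k ek] := @eps_cvg (d / 4); first by rewrite divr_gt0.
  exists (size (F k) * m k).+1, [set` F k]; split; first exact: finite_seq.
  move=> n; have [p pF|L Ll LP] := @pcurve_labels R X (repr (e n).1) (F k) (eps k) (m k)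
      (eps_gt0 k) (net k).
    exact: le_lt_trans (crossings_le_coll _ _ _ (Ge n)) (BG n k p pF).
  by exists L => //; apply: curve_labels_le Ll; lra.
exists phi => //; exists (\pi_(curve X)%qT h).
apply/cvg_mdistP => d /hP[N HN]; exists N => n Nn.
(* The representative of the class of [h] may differ from [h], but only at distance 0. *)
rewrite mdist_curveE pcurve_dist_sym; apply: le_lt_trans (HN n Nn).
apply: le_trans (pcurve_dist_triangle h _ _) _; rewrite -[leRHS]addr0 lerD2l.
suff : pcurve_equiv h (repr (\pi_(curve X)%qT h)) by move=> /asboolP ->.
by have /eqP := reprK (\pi_(curve X)%qT h); rewrite piE pcurve_equiv_sym.
Qed.

End compactness.

Section compactness.
Context {R : realType} {X : metricType R}.
Hypothesis cX : compact [set: X].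
Variables (eps : nat -> R) (F : nat -> seq X) (m : nat -> nat).
Hypothesis eps_gt0 : forall k, 0 < eps k.
Hypothesis eps_cvg : forall e, 0 < e -> exists k, eps k < e.
Hypothesis net : forall k y, exists2 p, p \in F k & mdist p y < eps k.

Lemma bounded_crossings_compact (G : nat -> collection X) :
  (forall n, bounded_crossings eps F m (G n)) ->
  exists2 phi, increasing_seq phi & exists H, forall e, 0 < e ->
    exists N, forall n, (N <= n)%N -> (coll_dist (G (phi n)) H < e%:E)%E.
Proof.
move=> BG.
have d0 (e : R) : 0 < e -> exists k, 8 * eps k < e.
  move=> e0; have [|k ek] := @eps_cvg (e / 8); first by rewrite divr_gt0.
  by exists k; lra.
have [C CP] := @uniform_enumeration R X (fun k => 8 * eps k) (fun k => size (F k) * m k)%N d0.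
have /choice[en enP] : forall n, exists en, enumeration (G n) en /\
    forall i e k, en i = Some e -> 8 * eps k < diam e.1 -> (i < C k)%N.
  move=> n; have [|en en1 en2] := CP (G n); last by exists en.
  by move=> k s us sG; exact: (bounded_crossings_size eps_gt0 net (BG n) us sG).
(* At index [i] the curves converge, or there is eventually no curve. *)
pose P i (phi : nat -> nat) := exists l : option (curve X),
  if l is Some h then
    forall e, 0 < e -> exists N, forall n, (N <= n)%N ->
      exists2 a, en (phi n) i = Some a & mdist a.1 h < e
  else exists N, forall n, (N <= n)%N -> en (phi n) i = None.
have P1 i phi : increasing_seq phi -> exists2 th, increasing_seq th & P i (phi \o th).
  move=> phii; have [|th thi [b thb]] :=
      @finite_range_constant_subsequence _ (fun n => isSome (en (phi n) i)).
    exact: finite_finset.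
  case: b thb => thb; last first.
    exists th => //; exists None; exists 0%N => n _ /=.
    by have := thb n; case: (en _ _).
  have /choice[a aP] : forall n, exists a, en (phi (th n)) i = Some a.
    by move=> n; have := thb n; case: (en _ _) => // a _; exists a.
  have [||th' thi' [h /cvg_mdistP hP]] :=
    @bounded_crossings_curves R X cX eps F m eps_gt0 eps_cvg net (G \o phi \o th) a.
  - by move=> n; exact: BG.
  - by move=> n; have [[H _ _] _] := enP (phi (th n)); exact: H (aP n).
  exists (th \o th'); first exact: increasing_seq_comp.
  exists (Some h) => e /hP[N HN]; exists N => n Nn.
  by exists (a (th' n)); [exact: aP | rewrite metric_sym; exact: HN].
have P2 i phi psi q : P i phi ->
    (exists2 th, increasing_seq th & forall n, psi (n + q)%N = phi (th n)) -> P i psi.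
  move=> [l lP] [th thi E]; exists l.
  have psiE n : (q <= n)%N -> exists2 k, psi n = phi k & (n - q <= k)%N.
    move=> qn; exists (th (n - q)%N); first by rewrite -E subnK.
    exact: increasing_seq_le.
  case: l lP => [h lP e /lP|] [N HN]; exists (N + q)%N => n Nn;
    have [|k -> nk] := psiE n; try lia; apply: HN; lia.
have [phi phii phiP] := diagonal_subsequence P1 P2.
have /choice[lim limP] := phiP.
(* Limits of diameter 0 are dropped, since collections contain no constant curves; the curves
   converging to them become small and may stay unmatched. *)
pose f i := if lim i is Some h then if 0 < diam h then Some h else None else None.
have fE i h : f i = Some h -> lim i = Some h /\ 0 < diam h.
  by rewrite /f; case: (lim i) => [h'|//]; case: ifP => // h0 [<-].
(* The index bound passes to the limit: a curve close enough to [h] still has diameter above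
   [8 * eps k]. *)
have fC i h k : f i = Some h -> 8 * eps k < diam h -> (i < C k)%N.
  move=> /fE[lh _] kh; have := limP i; rewrite lh => /(_ ((diam h - 8 * eps k) / 4)).
  case; first by rewrite divr_gt0 // subr_gt0.
  move=> N /(_ N (leqnn N))[a ea ah]; have [_ /(_ i a k ea)] := enP (phi N); apply.
  by have := diam_lip h a.1; rewrite metric_sym; lra.
have [||H [rho [rhoH rhof]]] := @collection_of_family R X f.
- by move=> i p /fE[].
- move=> d /d0[k kd]; exists (C k) => i p fi dp; apply: fC fi _.
  exact: lt_trans dp.
(* Indices from [C k] on carry only curves of diameter at most [8 * eps k < e / 2], in the sequence
   and in the limit; the finitely many others are controlled by convergence. *)
exists phi => //; exists H => e e0; have [|k ke] := d0 (e / 2); first by rewrite divr_gt0.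
pose good i n := if lim i is Some h then
  exists2 a, en (phi n) i = Some a & mdist a.1 h < e / 4 else en (phi n) i = None.
have [N _ HN] : \forall n \near \oo, forall i, (i < C k)%N -> good i n.
  apply: near_forall_lt => i; have := limP i; rewrite /good.
  case: (lim i) => [h /(_ (e / 4))|] [].
  - by rewrite divr_gt0.
  - by move=> N HN; exists N.
  - by move=> N HN; exists N.
exists N => n Nn; apply: (@le_lt_trans _ _ (e / 2)%:E); last by rewrite lte_fin; lra.
have [enG enC] := enP (phi n).
apply: (coll_dist_enum _ enG rhoH); first by rewrite ltW // divr_gt0.
move=> i; have [iC|Ci] := ltnP i (C k).
  have := HN n Nn i iC; have := rhof i; rewrite /good /f.
  case: (lim i) => [h|]; last by case: (rho i) => // _ ->.
  move=> rf [a -> ah]; move: rf; case: ifP => [h0|/negbT].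
    by case: (rho i) => [b [->]|//]; left; lra.
  rewrite -leNgt => h0; case: (rho i) => // _.
  by have := diam_lip a.1 h; lra.
have small1 a : en (phi n) i = Some a -> diam a.1 <= e / 2.
  by move=> ea; rewrite leNgt; apply/negP => ae;
    have := enC i a k ea (lt_trans ke ae); rewrite ltnNge Ci.
have small2 b : rho i = Some b -> diam b.1 <= e / 2.
  move=> rb; rewrite leNgt; apply/negP => be; have := rhof i; rewrite rb /= => /esym fi.
  by have := fC i b.1 k fi (lt_trans ke be); rewrite ltnNge Ci.
case Ea : (en (phi n) i) => [a|]; case Eb : (rho i) => [b|] //.
- by right; split; [exact: small1 | exact: small2].
- exact: small1.
- exact: small2.
Qed.

End compactness.

(** Without a net, points can be picked one by one, none close to an earlier one. The relation is
    arbitrary so as to cover both [mdist] and [coll_dist]. *)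
Lemma finite_net (T : eqType) (S : set T) (close : T -> T -> Prop) :
  (forall u : nat -> T, (forall n, S (u n)) -> exists i j, (i < j)%N /\ close (u i) (u j)) ->
  exists s : seq T, forall x, S x -> exists2 y, y \in s & close y x.
Proof.
move=> H; apply: contrapT => /forallNP nonet.
have /choice[pick pickP] : forall s : seq T, exists x,
    S x /\ forall y, y \in s -> ~ close y x.
  move=> s; have /existsNP[x /not_implyP[Sx nx]] := nonet s.
  by exists x; split => // y ys yx; apply: nx; exists y.
pose s := fix s n := if n is k.+1 then pick (s k) :: s k else [::].
have us i n : (i < n)%N -> pick (s i) \in s n.
  elim: n => // n ih; rewrite ltnS leq_eqVlt => /orP[/eqP ->|/ih]; rewrite inE.
    by rewrite eqxx.
  by move=> ->; rewrite orbT.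
have [|i [j [ij]]] := H (fun n => pick (s n)); first by move=> n; have [] := pickP (s n).
by have [_ /(_ _ (us _ _ ij))] := pickP (s j).
Qed.

Lemma compact_net (R : realType) (X : metricType R) (e : R) : compact [set: X] -> 0 < e ->
  exists s : seq X, forall y, exists2 p, p \in s & mdist p y < e.
Proof.
move=> cX e0; suff [s sP] : exists s : seq X, forall y, [set: X] y ->
    exists2 p, p \in s & mdist p y < e by exists s => y; exact: sP.
apply: finite_net => u Su.
have [phi phii [l _ /cvg_mdistP ul]] := compact_cvg_subsequence cX Su.
have [|N HN] := ul (e / 2); first by rewrite divr_gt0.
exists (phi N), (phi N.+1); split; first by have /increasing_seqP/(_ N) := phii.
have := HN N (leqnn N); have := HN N.+1 (leqnSn N).
have := metric_triangle (u (phi N)) l (u (phi N.+1)).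
by rewrite (metric_sym (u (phi N)) l) /=; lra.
Qed.

(** * Topology of the space of collections *)

Section coll_topology.
Context {R : realType} {X : metricType R}.
Local Notation T := (collection X).

Lemma entourage_collP (A : set (T * T)) : entourage A <->
  exists2 e : R, 0 < e & forall G H, (coll_dist G H < e%:E)%E -> A (G, H).
Proof.
split=> [[e e0 eA]|[e e0 eA]].
  by exists e => // G H GH; apply: eA.
by exists e => // -[G H] GH; exact: eA.
Qed.

Lemma cvg_collP (u : nat -> T) (l : T) : u @ \oo --> l <-> forall e : R, 0 < e ->
  exists N, forall n, (N <= n)%N -> (coll_dist l (u n) < e%:E)%E.
Proof.
split=> [ul e e0|H A /nbhs_collP[e e0 eA]].
  have [|N _ HN] := ul [set G | (coll_dist l G < e%:E)%E].
    by apply/nbhs_collP; exists e.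
  by exists N => n Nn; exact: HN.
by have [N HN] := H e e0; exists N => // n /= Nn; apply: eA; exact: HN.
Qed.

Lemma countable_uniformity_coll : countable_uniformity T.
Proof.
apply/countable_uniformityP.
exists (fun n => [set GH : T * T | (coll_dist GH.1 GH.2 < (2^-1 ^+ n)%:E)%E]).
  move=> A /entourage_collP[e e0 eA]; have [n ne] := half_expr_lt e0.
  exists n => -[G H] /= GH; apply: eA; apply: lt_trans GH _.
  by rewrite lte_fin.
by move=> n; apply/entourage_collP; exists (2^-1 ^+ n); rewrite ?exprn_gt0.
Qed.

Definition seq_compact (S : set T) := forall u : nat -> T, (forall n, S (u n)) ->
  exists2 phi, increasing_seq phi & exists l : T, u \o phi @ \oo --> l.

Lemma closure_collP (S : set T) G : closure S G <->
  forall e : R, 0 < e -> exists2 H, S H & (coll_dist G H < e%:E)%E.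
Proof.
split=> [SG e e0|H A /nbhs_collP[e e0 eA]].
  have [|H [SH GH]] := SG [set H | (coll_dist G H < e%:E)%E]; last by exists H.
  by apply/nbhs_collP; exists e.
by have [K SK GK] := H e e0; exists K; split => //; exact: eA.
Qed.

(** Needed because [bounded_crossings] is an intersection of open sets, while [prohorov] asks for
    closed ones. *)
Lemma seq_compact_closure (S : set T) : seq_compact S -> seq_compact (closure S).
Proof.
move=> cS u Su.
have /choice[v vP] : forall n, exists v, S v /\ (coll_dist (u n) v < (2^-1 ^+ n)%:E)%E.
  by move=> n; have [|v Sv uv] := (closure_collP _ _).1 (Su n) (2^-1 ^+ n); [rewrite exprn_gt0|exists v].
have [|phi phii [l /cvg_collP vl]] := cS v; first by move=> n; have [] := vP n.
exists phi => //; exists l; apply/cvg_collP => e e0.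
have e4 : 0 < e / 4 by rewrite divr_gt0.
have [N HN] := vl _ e4; have [K Ke] := half_expr_lt e4.
exists (maxn N K) => n; rewrite geq_max => /andP[Nn Kn].
apply: (@le_lt_trans _ _ (3 * (e / 4))%:E); last by rewrite lte_fin; lra.
apply: (coll_dist_triangle (H := v (phi n)) (ltW e4)); first exact: HN.
rewrite coll_dist_sym; have [_ /lt_trans] := vP (phi n); apply; rewrite lte_fin.
apply: le_lt_trans Ke; apply: half_expr_le.
exact: leq_trans Kn (increasing_seq_le phii n).
Qed.

Lemma seq_compact_net (S : set T) (e : R) : seq_compact S -> 0 < e ->
  exists s : seq T, forall G, S G -> exists2 H, H \in s & (coll_dist H G < e%:E)%E.
Proof.
move=> cS e0; apply: finite_net => u Su.
have [phi phii [l /cvg_collP ul]] := cS u Su.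
have e4 : 0 < e / 4 by rewrite divr_gt0.
have [N HN] := ul _ e4; exists (phi N), (phi N.+1); split.
  by have /increasing_seqP/(_ N) := phii.
apply: (@le_lt_trans _ _ (3 * (e / 4))%:E); last by rewrite lte_fin; lra.
apply: (coll_dist_triangle (H := l) (ltW e4)); first by rewrite coll_dist_sym; exact: HN.
exact: (HN N.+1).
Qed.

(* Radii 4 e and 40 e absorb the factor 3 of the relaxed triangle inequality. *)
Lemma coll_countable_base (K : nat -> set T) : (forall k, seq_compact (K k)) ->
  exists A : nat -> set T, (forall i, open (A i)) /\
    forall k G U, K k G -> open U -> U G -> exists i, A i G /\ closure (A i) `<=` U.
Proof.
move=> cK.
have /choice[s sP] : forall kj : nat * nat, exists s : seq T, forall G, K kj.1 G ->
    exists2 H, H \in s & (coll_dist H G < (2^-1 ^+ kj.2)%:E)%E.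
  by move=> [k j]; apply: seq_compact_net => //; rewrite exprn_gt0.
(* Openness of a ball does not follow from the relaxed triangle inequality, hence the interior. *)
pose A i := if choice.pickle_inv i is Some kjl then
  [set G | (coll_dist (nth (point : T) (s kjl.1) kjl.2) G < (4 * 2^-1 ^+ kjl.1.2)%:E)%E]° else set0.
exists A; split=> [i|k G U KG oU UG].
  by rewrite /A; case: choice.pickle_inv => [?|]; [exact: open_interior | exact: open0].
have [e e0 eU] := (nbhs_collP _ _).1 (open_nbhs_nbhs (conj oU UG)).
have [j je] : exists j, 2^-1 ^+ j < e / 40 by apply: half_expr_lt; rewrite divr_gt0.
have d0 : 0 < 2^-1 ^+ j :> R by rewrite exprn_gt0.
have [H Hs HG] := sP (k, j) G KG.
exists (choice.pickle ((k, j), index H (s (k, j)))).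
rewrite /A choice.pickleK_inv /= nth_index //; set B := [set _ | _].
have BG : B° G.
  apply/nbhs_collP; exists (2^-1 ^+ j) => // G' GG'.
  apply: le_lt_trans (coll_dist_triangle (ltW d0) HG GG') _.
  by rewrite lte_fin; lra.
split => // W /closure_collP/(_ _ d0)[Z BZ WZ]; apply: eU.
have HW : (coll_dist H W < (13 * 2^-1 ^+ j)%:E)%E.
  apply: (@le_lt_trans _ _ (3 * (4 * 2^-1 ^+ j))%:E); last by rewrite lte_fin; lra.
  have d4 : 0 <= 4 * 2^-1 ^+ j :> R by lra.
  apply: (coll_dist_triangle (H := Z) d4); first exact: (interior_subset BZ).
  rewrite coll_dist_sym; apply: lt_trans WZ _; rewrite lte_fin; lra.
apply: (@le_lt_trans _ _ (3 * (13 * 2^-1 ^+ j))%:E); last by rewrite lte_fin; lra.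
have d13 : 0 <= 13 * 2^-1 ^+ j :> R by lra.
apply: (coll_dist_triangle (H := H) d13) => //.
rewrite coll_dist_sym; apply: lt_trans HG _; rewrite lte_fin; lra.
Qed.

End coll_topology.

(** * Regularity and precompactness *)

Lemma cvge0P (R : realType) (a : nat -> \bar R) : (forall n, (0 <= a n)%E) ->
  a @ \oo --> 0%E <-> forall e : R, 0 < e -> exists N, forall n, (N <= n)%N -> (a n <= e%:E)%E.
Proof.
move=> a0; split=> [/fine_cvgP[fa ca] e e0|H].
  move/cvgrPdist_le : ca => /(_ e e0) ca.
  have [N _ HN] : \forall n \near \oo, (a n <= e%:E)%E.
    near=> n; have fn : a n \is a fin_num by near: n.
    rewrite -(fineK fn) lee_fin; apply: le_trans (ler_norm _) _.
    by rewrite -normrN -sub0r; near: n.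
  by exists N.
apply/fine_cvgP; split.
  have [N HN] := H 1 ltr01; exists N => // n /= /HN an.
  by rewrite ge0_fin_numE // (le_lt_trans an) // ltry.
apply/cvgrPdist_le => e e0; have [N HN] := H e e0; exists N => // n /= /HN an.
have fn : a n \is a fin_num by rewrite ge0_fin_numE // (le_lt_trans an) // ltry.
by rewrite sub0r normrN ger0_norm ?fine_ge0 // -lee_fin fineK.
Unshelve. all: by end_near. Qed.

Section regularity.
Context {R : realType} {X : metricType R}.
Local Notation M1 := (probability (borel_collection X) R).
Implicit Types M : set M1.

Let many x (r r' : R) (N : nat) : set (collection X) :=
  [set G | (N%:R%:E <= coll_crossings G x r r')%E].

Let many_closed x r r' N : r < r' -> closed (many x r r' N).
Proof.
move=> rr; rewrite -[many _ _ _ _]setCK; apply: open_closedC.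
rewrite (_ : ~` _ = [set G | (coll_crossings G x r r' < N%:R%:E)%E]).
  exact: open_crossings_lt.
by apply/seteqP; split=> G /=; rewrite /many /= ltNge => /negP.
Qed.

Let many_le x r r' N N' : (N <= N')%N -> many x r r' N' `<=` many x r r' N.
Proof. by move=> NN G; apply: le_trans; rewrite lee_fin ler_nat. Qed.

Let many_measurable x r r' N : r < r' ->
  measurable (many x r r' N : set (borel_collection X)).
Proof. by move=> rr; apply: closed_borel; exact: many_closed. Qed.

Lemma regular_measuresP M : regular_measures M <->
  forall x (r r' e : R), 0 < r -> r < r' -> 0 < e ->
    exists N, forall mu : M1, M mu ->
      (mu [set G | (N%:R%:E <= coll_crossings G x r r')%E] <= e%:E)%E.
Proof.
have s0 (x : X) r r' N : (0 <= esup0 [set mu (many x r r' N) | mu in M])%E.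
  by apply: ereal_sup_ubound; left.
split=> [H x r r' e r0 rr e0|H x r r' r0 rr].
  have /(cvge0P (s0 x r r'))/(_ e e0)[N /(_ N (leqnn N))] := H x r r' r0 rr.
  by move=> /(esup0_leP _ _ (ltW e0)) HN; exists N.
apply/(cvge0P (s0 x r r')) => e e0; have [N HN] := H x r r' e r0 rr e0.
exists N => n Nn; apply/(esup0_leP _ _ (ltW e0)) => mu Mmu.
apply: le_trans (HN mu Mmu); apply: le_measure; rewrite ?inE; [exact: many_measurable..|].
exact: many_le.
Qed.

Lemma precompact_regular M : weakly_precompact M -> regular_measures M.
Proof.
move=> pM; apply/regular_measuresP => x r r' e r0 rr e0.
apply: contrapT => /forallNP nN.
have /choice[mu_ muP] : forall N, exists mu : M1, M mu /\ (e%:E < mu (many x r r' N))%E.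
  move=> N; have /existsNP[mu /not_implyP[Mmu /negP]] := nN N.
  by rewrite -ltNge; exists mu.
have [|phi [phii [mu wc]]] := pM mu_; first by move=> N; have [] := muP N.
have e2 : 0 < e / 2 by rewrite divr_gt0.
(* For fixed [K], the event with threshold [phi n >= K] is contained in the one with threshold [K],
   so the latter has mass above [e] along the subsequence; the portmanteau bound loses [e / 2]. *)
have lower K : ((e / 2)%:E <= mu (many x r r' K))%E.
  have [N _ HN] := portmanteau_closed (mu_ := mu_ \o phi) countable_uniformity_coll wc
    (@many_closed x r r' K rr) e2.
  have := HN (maxn N K) (leq_maxl _ _); have [_] := muP (phi (maxn N K)).
  have : (mu_ (phi (maxn N K)) (many x r r' (phi (maxn N K))) <=
          mu_ (phi (maxn N K)) (many x r r' K))%E.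
    apply: le_measure; rewrite ?inE; [exact: many_measurable..|].
    apply: many_le; apply: leq_trans (leq_maxr N K) _; exact: increasing_seq_le.
  move=> h1 h2 /= h3; have := lt_le_trans (lt_le_trans h2 h1) h3.
  have fm : mu (many x r r' K) \is a fin_num.
    by apply: fin_num_measure; exact: many_measurable.
  by rewrite -(fineK fm) -EFinD lte_fin lee_fin; lra.
have empty : \bigcap_K many x r r' K = set0.
  rewrite -subset0 => G HG; have fG := @coll_crossings_fin R X G x r r' rr.
  have G0 : (0 <= coll_crossings G x r r')%E.
    by apply: esum_ge0 => e' _; exact: crossings_ge0.
  have fn : coll_crossings G x r r' \is a fin_num by rewrite ge0_fin_numE.
  have := HG (Num.truncn (fine (coll_crossings G x r r'))).+1 I.
  by rewrite /many /= -(fineK fn) lee_fin leNgt truncnS_gt.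
have : mu (many x r r' K) @[K --> \oo] --> mu set0.
  rewrite -empty; apply: nonincreasing_cvg_mu.
  - by rewrite ltey_eq fin_num_measure //; exact: many_measurable.
  - by move=> K; exact: many_measurable.
  - by rewrite empty.
  - by move=> K K' KK; apply/subsetPset; exact: many_le.
rewrite measure0 => /(cvge0P (fun K => measure_ge0 mu (many x r r' K))) H.
have [|N HN] := H (e / 4); first by rewrite divr_gt0.
by have := le_trans (lower N) (HN N (leqnn N)); rewrite lee_fin; lra.
Qed.

Lemma regular_precompact M : compact [set: X] -> regular_measures M -> weakly_precompact M.
Proof.
move=> cX /regular_measuresP rM mu_ Mmu.
pose eps k : R := 2^-1 ^+ k.
have eps0 k : 0 < eps k by rewrite exprn_gt0.
have eps2 k : eps k < 2 * eps k by have := eps0 k; lra.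
have /choice[F net] : forall k, exists s : seq X, forall y, exists2 p, p \in s & mdist p y < eps k.
  by move=> k; exact: compact_net.
(* The total error [eps u] is split with weight [2^-(k+1)] for scale [k], then among the net points
   of that scale; the successor keeps the divisor nonzero for an empty net. *)
pose d u k : R := eps u / (2 ^ k.+1)%:R / (size (F k)).+1%:R.
have d0 u k : 0 < d u k by rewrite !divr_gt0 // ltr0n expn_gt0.
have /choice[N NP] : forall ukp : nat * nat * X, exists N, forall mu : M1, M mu ->
    (mu (many ukp.2 (eps ukp.1.2) (2 * eps ukp.1.2) N) <= (d ukp.1.1 ukp.1.2)%:E)%E.
  by move=> [[u k] p]; exact: rM.
pose m u k := (\max_(p <- F k) N (u, k, p))%N.
pose K u := closure (bounded_crossings eps F (m u)).
have cK u : seq_compact (K u).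
  apply: seq_compact_closure => G GS.
  have [phi phii [H HP]] := @bounded_crossings_compact R X cX eps F (m u) eps0 (@half_expr_lt R) net G GS.
  exists phi => //; exists H; apply/cvg_collP => e /HP[n nP].
  by exists n => i /nP; rewrite coll_dist_sym.
have [A [oA baseA]] := coll_countable_base cK.
have tightK (e : R) : 0 < e -> exists u, forall n, (1 - e%:E <= mu_ n (K u))%E.
  move=> /half_expr_lt[u ue]; exists u => n.
  pose B k := \big[setU/set0]_(p <- F k) many p (eps k) (2 * eps k) (m u k).
  have mB k : measurable (B k : set (borel_collection X)).
    by rewrite /B; elim: (F k) => [|p s ih]; rewrite ?big_nil // big_cons;
      apply: measurableU => //; exact: many_measurable.
  have BK : ~` (\bigcup_k B k) `<=` K u.
    apply: subset_trans (@subset_closure _ _) => G nB k p pF.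
    rewrite ltNge; apply/negP => Gp; apply: nB; exists k => //.
    by rewrite /B -bigcup_seq; exists p.
  have muB k : (mu_ n (B k) <= (eps u / (2 ^ k.+1)%:R)%:E)%E.
    apply: (@le_trans _ _ ((size (F k))%:R * d u k)%:E).
      have : forall p, p \in F k -> (mu_ n (many p (eps k) (2 * eps k) (m u k)) <= (d u k)%:E)%E.
        move=> p pF; apply: le_trans (NP (u, k, p) _ (Mmu n)).
        apply: le_measure; rewrite ?inE; [exact: many_measurable..|].
        by apply: many_le; rewrite /m (big_rem p pF) /= leq_maxl.
      rewrite /B; elim: (F k) => [|p s ih] H; first by rewrite big_nil measure0 mul0r.
      rewrite big_cons.
      have -> : (size (p :: s))%:R * d u k = d u k + (size s)%:R * d u k.
        by rewrite -[size _]/(size s).+1 -nat1r mulrDl mul1r.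
      rewrite EFinD.
      have ms : measurable ((\big[setU/set0]_(p <- s) many p (eps k) (2 * eps k) (m u k)) : set (borel_collection X)).
        elim: (s) => [|q t iht]; rewrite ?big_nil // big_cons.
        by apply: measurableU => //; exact: many_measurable.
      apply: le_trans (measureU2 _ _ ms) _; first exact: many_measurable.
      apply: leeD; first by apply: H; rewrite mem_head.
      by apply: ih => q qs; apply: H; rewrite inE qs orbT.
    rewrite lee_fin /d mulrCA ger_pMr ?divr_gt0 ?ltr0n ?expn_gt0 //.
    by rewrite ler_pdivrMr // mul1r ler_nat.
  have muU : (mu_ n (\bigcup_k B k) <= (eps u)%:E)%E.
    apply: le_trans (measure_sigma_subadditive _ mB _ (@subset_refl _ _)) _.
      exact: bigcupT_measurable.
    apply: le_trans (epsilon_trick0 xpredT (ltW (eps0 u))).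
    by apply: lee_nneseries => // k _; exact: muB.
  have mU : measurable (\bigcup_k B k : set (borel_collection X)) by exact: bigcupT_measurable.
  apply: (@le_trans _ _ (mu_ n (~` \bigcup_k B k))).
    rewrite probability_setC // leeB // (le_trans muU) // lee_fin; exact: ltW.
  apply: le_measure; rewrite ?inE //; first exact: measurableC.
  by apply: closed_borel; exact: closed_closure.
have [phi phii [mu muP]] := @prohorov R (collection X) A K mu_ oA
  (fun u => @closed_closure _ _) cK baseA tightK.
by exists phi; split => //; exists mu.
Qed.

End regularity.

Theorem theorem1p5 (R : realType) (X : metricType R)
  (X_compact : compact [set: X]) (X_geodesic : geodesic X)
  (M : set (probability (borel_collection X) R)) :
  weakly_precompact M <-> regular_measures M.
Proof. by split; [exact: precompact_regular | exact: regular_precompact]. Qed.
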